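(* Let $d\in\mathbb{N}$ and let $M(t)=t\log(e+t)$, $t>0$. There is a constant $c_d$ depending only on $d$ such that for every $f\in L_M(\mathbb{T}^d)$, $$\Big\|(1-\Delta_{\mathbb{T}^d})^{-\frac{d}{4}}M_f(1-\Delta_{\mathbb{T}^d})^{-\frac{d}{4}}\Big\|_{1,\infty}\leq c_d\|f\|_{L_M(\mathbb{T}^d)}.$$
   Context: $\mathbb{T}^d$ is the $d$-dimensional torus, identified with the cube $[-\pi,\pi]^d$ with opposite faces glued, equipped with the normalised Haar measure $m$; $\Delta_{\mathbb{T}^d}$ is the Laplace operator on $L_2(\mathbb{T}^d)$ (so $(1-\Delta_{\mathbb{T}^d})^{s}$ acts on $e^{i\langle n,x\rangle}$, $n\in\mathbb{Z}^d$, by multiplication by $(1+|n|^2)^{s}$). $M_f$ denotes the operator of multiplication by $f$; for unbounded $f$ the operator $(1-\Delta_{\mathbb{T}^d})^{-d/4}M_f(1-\Delta_{\mathbb{T}^d})^{-d/4}$ is understood as the operator on $L_2(\mathbb{T}^d)$ associated with the sesquilinear form $(u,v)\mapsto\int f\,((1-\Delta)^{-d/4}u)\overline{(1-\Delta)^{-d/4}v}\,dm$. For an even convex function $M$ with $M(0)=0$ the Orlicz space $L_M(\Omega,\nu)$ consists of measurable $f$ with $M(\lambda|f|)\in L_1$ for some $\lambda>0$, normed by $\|f\|_{L_M}=\inf\{\lambda>0:\int M(|f|/\lambda)\,d\nu\le 1\}$. For a compact operator $T$, $\mu(k,T)=\inf\{\|T-R\|_\infty:\ \mathrm{rank}(R)\le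 k\}$, and $\|T\|_{p,\infty}=\sup_{k\ge0}(k+1)^{1/p}\mu(k,T)$; $\mathcal{L}_{p,\infty}$ is the set of operators with finite $\|\cdot\|_{p,\infty}$. *)

(* Defs.v *)
From HB Require Import structures.
From mathcomp Require Import all_boot all_order all_algebra.
From mathcomp Require Import all_classical all_reals all_analysis.
From mathcomp Require Import complex.
Set Implicit Arguments. Unset Strict Implicit. Unset Printing Implicit Defensive.
Import Order.TTheory GRing.Theory Num.Theory.
Import numFieldNormedType.Exports.
Local Open Scope classical_set_scope.
Local Open Scope ring_scope.

Section TorusDefs.
Context {R : realType}.

(** Points of T^d are d-tuples of reals, representatives in [-pi,pi]^d. *)

(** Integral of a nonnegative function w.r.t. the normalised Haar measure
    on [-pi,pi]^d, computed as an iterated Lebesgue integral (Tonelli). *)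
Fixpoint tint (n : nat) : (n.-tuple R -> \bar R) -> \bar R :=
  match n with
  | 0 => fun g => g [tuple]
  | n'.+1 => fun g =>
      (((2 * pi)^-1)%:E *
       \int[@lebesgue_measure R]_(x in `[(- pi)%R, pi%R]) tint (fun t => g (cons_tuple x t)))%E
  end.

Definition haar_int (d : nat) (g : d.-tuple R -> R) : R :=
  fine (tint (fun x => (Num.max (g x) 0)%:E)) -
  fine (tint (fun x => (Num.max (- g x) 0)%:E)).

Definition cabs (z : R[i]) : R := Num.sqrt (complex.Re z ^+ 2 + complex.Im z ^+ 2).

Definition cconj (z : R[i]) : R[i] := Complex (complex.Re z) (- complex.Im z).

Definition Mfun (t : R) : R := t * ln (expR 1 + t).

Definition cmeasurable (d : nat) (f : d.-tuple R -> R[i]) : Prop :=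
  measurable_fun setT (fun x => complex.Re (f x)) /\ measurable_fun setT (fun x => complex.Im (f x)).

Definition in_LM (d : nat) (f : d.-tuple R -> R[i]) : Prop :=
  cmeasurable f /\
  exists l : R, 0 < l /\ (tint (fun x => (Mfun (l * cabs (f x)))%:E) < +oo)%E.

Definition LM_norm (d : nat) (f : d.-tuple R -> R[i]) : \bar R :=
  ereal_inf [set l%:E | l in
    [set l : R | 0 < l /\ (tint (fun x => (Mfun (cabs (f x) / l))%:E) <= 1)%E]].

Definition dotZ (d : nat) (n : d.-tuple int) (x : d.-tuple R) : R :=
  \sum_(i < d) (tnth n i)%:~R * tnth x i.
Definition nsq (d : nat) (n : d.-tuple int) : R :=
  \sum_(i < d) ((tnth n i)%:~R) ^+ 2.
Definition expi (t : R) : R[i] := Complex (cos t) (sin t).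

(** multiplier of (1 - Delta)^{-d/4} at frequency n *)
Definition wgt (d : nat) (n : d.-tuple int) : R :=
  powR (1 + nsq n) (- (d%:R / 4)).

(** A trigonometric polynomial u = sum_{n in S} c n e^{i<n,x>} (S duplicate-free)
    and its image (1-Delta)^{-d/4} u. *)
Definition Jtrig (d : nat) (S : seq (d.-tuple int)) (c : d.-tuple int -> R[i])
  (x : d.-tuple R) : R[i] :=
  \sum_(n <- S) (Complex (wgt n) 0 * c n * expi (dotZ n x)).

Definition unit_trig (d : nat) (S : seq (d.-tuple int)) (c : d.-tuple int -> R[i]) :=
  uniq S /\ \sum_(n <- S) cabs (c n) ^+ 2 <= 1.

(** the sesquilinear form q_f(u,v) = int f ((1-Delta)^{-d/4}u) conj((1-Delta)^{-d/4}v) dm *)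
Definition qform (d : nat) (f : d.-tuple R -> R[i])
  (S : seq (d.-tuple int)) (c : d.-tuple int -> R[i])
  (S' : seq (d.-tuple int)) (c' : d.-tuple int -> R[i]) : R[i] :=
  let g := fun x => f x * Jtrig S c x * cconj (Jtrig S' c' x) in
  Complex (haar_int (fun x => complex.Re (g x))) (haar_int (fun x => complex.Im (g x))).

(** elements of L_2(T^d), through their Fourier coefficients (ell^2(Z^d)) *)
Definition sqsum (d : nat) (a : d.-tuple int -> R[i]) : Prop :=
  exists B : R, forall S : seq (d.-tuple int), uniq S ->
    \sum_(n <- S) cabs (a n) ^+ 2 <= B.

Definition inner_trig (d : nat) (S : seq (d.-tuple int)) (c : d.-tuple int -> R[i])
  (a : d.-tuple int -> R[i]) : R[i] :=
  \sum_(n <- S) (c n * cconj (a n)).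

(** <R u, v> for the operator R = sum_{j<k} <., a_j> b_j of rank <= k *)
Definition rank_form (d k : nat) (a b : 'I_k -> d.-tuple int -> R[i])
  (S : seq (d.-tuple int)) (c : d.-tuple int -> R[i])
  (S' : seq (d.-tuple int)) (c' : d.-tuple int -> R[i]) : R[i] :=
  \sum_(j < k) (inner_trig S c (a j) * cconj (inner_trig S' c' (b j))).

(** ||T_f - R||_infty, computed on the dense subspace of trigonometric
    polynomials (+oo if the form is unbounded). *)
Definition dist_norm (d k : nat) (f : d.-tuple R -> R[i])
  (a b : 'I_k -> d.-tuple int -> R[i]) : \bar R :=
  ereal_sup [set y : \bar R | exists (S : seq (d.-tuple int)) (c : d.-tuple int -> R[i])
      (S' : seq (d.-tuple int)) (c' : d.-tuple int -> R[i]),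
      [/\ unit_trig S c, unit_trig S' c' &
        y = (cabs (qform f S c S' c' - rank_form a b S c S' c'))%:E]].

(** singular value mu(k, T_f): distance to operators of rank <= k *)
Definition sing_val (d : nat) (f : d.-tuple R -> R[i]) (k : nat) : \bar R :=
  ereal_inf [set y : \bar R | exists a b : 'I_k -> d.-tuple int -> R[i],
      (forall j, sqsum (a j) /\ sqsum (b j)) /\ y = dist_norm f a b].

Definition weakL1_norm (d : nat) (f : d.-tuple R -> R[i]) : \bar R :=
  ereal_sup [set ((k.+1)%:R%:E * sing_val f k)%E | k in [set: nat]].

End TorusDefs.

(* Main.v *)
(** The operator is [A^* sgn(f) A] with [A = V^(1/2) (1-Delta)^(-d/4)] and
    [V = |f|], so after removing a finite rank part it is enough to make
    [|Au|^2 = int V |(1-Delta)^(-d/4) u|^2] at most [C/N |u|^2] on the complement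
    of at most [C N] orthonormal vectors.  This is a Cwikel-type argument.

    Write [w_n = (1+|n|^2)^(-d/4)].  Exponentials with [w_n^-2 <= N] go into the
    finite rank part; there are [O(N)] of them.  At a point [x] the remaining
    frequencies are split at [w_n^-2 ~ N max(V(x),1)], rounded to a power of 4.
    - Above the threshold, summing over the dyadic levels of [V] and dropping the
      restriction to the level sets, Plancherel gives
      [sum_j 4^(j+1) sum_(w_n^-2 > N 4^j) w_n^2 |u_n|^2 <= C/N |u|^2].
    - Below the threshold the operator is Hilbert-Schmidt, with squared norm
      [int V sum_(N < w_n^-2 <= N V) w_n^2 <= C int V log(e+V)].  Hence at most
      [C N] orthonormal vectors have image of squared norm above [1/N]: a maximal
      such family completes the finite rank part.

    Starting at [N] instead of [1] is what removes the [log N] that the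
    Hilbert-Schmidt norm would otherwise carry. *)
Require Import Defs.
From HB Require Import structures.
From mathcomp Require Import all_boot all_order all_algebra.
From mathcomp Require Import all_classical all_reals all_analysis.
From mathcomp Require Import measurable_realfun ring lra zify.
From mathcomp Require Import complex.
Import Order.TTheory GRing.Theory Num.Theory.
Import numFieldNormedType.Exports.
Set Implicit Arguments. Unset Strict Implicit. Unset Printing Implicit Defensive.
Local Open Scope ring_scope.

(** * Conjugation and modulus of complex numbers *)

Section ComplexModulus.
Variable R : realType.
Implicit Types z w : R[i].
Local Open Scope complex_scope.

Lemma cconjE z : cconj z = conjc z.
Proof. by case: z. Qed.

Lemma cconjM z w : cconj (z * w) = cconj z * cconj w.
Proof. by rewrite !cconjE rmorphM. Qed.

Lemma cconjB z w : cconj (z - w) = cconj z - cconj w.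
Proof. by rewrite !cconjE rmorphB. Qed.

Lemma cconjD z w : cconj (z + w) = cconj z + cconj w.
Proof. by rewrite !cconjE rmorphD. Qed.

Lemma cconj0 : cconj (0 : R[i]) = 0.
Proof. by rewrite cconjE conjc0. Qed.

Lemma cconj_sum (J : Type) (r : seq J) (P : pred J) (F : J -> R[i]) :
  cconj (\sum_(j <- r | P j) F j) = \sum_(j <- r | P j) cconj (F j).
Proof. exact: (big_morph _ cconjD cconj0). Qed.

Lemma cconjK : involutive (@cconj R).
Proof. by move=> z; rewrite !cconjE conjcK. Qed.

Lemma realcM (x y : R) : (x * y)%:C = x%:C * y%:C.
Proof. exact: rmorphM. Qed.

Lemma realcB (x y : R) : (x - y)%:C = x%:C - y%:C.
Proof. exact: rmorphB. Qed.

Lemma realc_sum (J : Type) (r : seq J) (P : pred J) (F : J -> R) :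
  (\sum_(j <- r | P j) F j)%:C = \sum_(j <- r | P j) (F j)%:C.
Proof. exact: rmorph_sum. Qed.

Lemma ReM z w :
  complex.Re (z * w) =
  complex.Re z * complex.Re w + - complex.Im z * complex.Im w.
Proof. by case: z w => [a b] [a' b'] /=; rewrite mulNr. Qed.

Lemma ImM z w :
  complex.Im (z * w) = complex.Re z * complex.Im w + complex.Im z * complex.Re w.
Proof. by case: z w => [a b] [a' b']. Qed.

Lemma Re_realM (a : R) z : complex.Re (a%:C * z) = a * complex.Re z.
Proof. by case: z => b c /=; rewrite mul0r subr0. Qed.

Lemma Im_realM (a : R) z : complex.Im (a%:C * z) = a * complex.Im z.
Proof. by case: z => b c /=; rewrite mul0r addr0. Qed.

Lemma cabs_normc z : cabs z = Normc.normc z.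
Proof. by case: z. Qed.

Lemma cabs_ge0 z : 0 <= cabs z.
Proof. exact: sqrtr_ge0. Qed.

Lemma cabs_sqr z : cabs z ^+ 2 = complex.Re z ^+ 2 + complex.Im z ^+ 2.
Proof. by rewrite sqr_sqrtr// addr_ge0// sqr_ge0. Qed.

Lemma cabs_sqrC z : (cabs z ^+ 2)%:C = z * cconj z.
Proof. by rewrite cabs_sqr add_Re2_Im2 sqr_normc cconjE. Qed.

Lemma cabsM z w : cabs (z * w) = cabs z * cabs w.
Proof. by rewrite !cabs_normc Normc.normcM. Qed.

Lemma cabsD z w : cabs (z + w) <= cabs z + cabs w.
Proof. by rewrite !cabs_normc le_normcD. Qed.

Lemma cabsJ z : cabs (cconj z) = cabs z.
Proof. by case: z => a b; rewrite /cabs /= sqrrN. Qed.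

Lemma cabs_real (x : R) : cabs x%:C = `|x|.
Proof. by rewrite /cabs /= expr0n addr0 sqrtr_sqr. Qed.

Lemma cabs0 : cabs (0 : R[i]) = 0.
Proof. by rewrite (cabs_real 0) normr0. Qed.

Lemma cabs_ge_Re z : `|complex.Re z| <= cabs z.
Proof. by rewrite -sqrtr_sqr ler_wsqrtr// lerDl sqr_ge0. Qed.

Lemma cabs_ge_Im z : `|complex.Im z| <= cabs z.
Proof. by rewrite -sqrtr_sqr ler_wsqrtr// lerDr sqr_ge0. Qed.

Lemma cabs_le_ReIm z : cabs z <= `|complex.Re z| + `|complex.Im z|.
Proof.
rewrite -(@ler_pXn2r _ 2)// ?nnegrE ?cabs_ge0 ?addr_ge0// cabs_sqr sqrrD.
by rewrite !real_normK ?num_real// lerD2r lerDl mulrn_wge0// mulr_ge0.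
Qed.

Lemma cabs_sqrD z w : cabs (z + w) ^+ 2 <= 2 * cabs z ^+ 2 + 2 * cabs w ^+ 2.
Proof.
have := cabsD z w; have := cabs_ge0 (z + w).
by have := sqr_ge0 (cabs z - cabs w); nra.
Qed.

End ComplexModulus.

(** * Enlarging the index list of a finite sum *)

Section FiniteSums.
Variable (I : eqType).

Lemma big_extend (V : nmodType) (S S1 : seq I) (F : I -> V) :
  uniq S -> uniq S1 -> {subset S <= S1} ->
  (forall n, n \notin S -> F n = 0) ->
  \sum_(n <- S1) F n = \sum_(n <- S) F n.
Proof.
move=> uS uS1 SS1 F0.
rewrite (bigID (fun n => n \in S))/= [X in _ + X]big1 ?addr0; last first.
  by move=> n; apply: F0.
rewrite -big_filter; apply: perm_big; apply: uniq_perm => //.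
  exact: filter_uniq.
by move=> n; rewrite mem_filter; apply/andb_idr; exact: SS1.
Qed.

End FiniteSums.

(** * Hilbert space geometry on finite lists of indices *)

Section FiniteHilbert.
Variables (R : realType) (I : eqType).
Implicit Types (S : seq I) (u v : I -> R[i]) (q : nat -> I -> R[i]).
Local Open Scope complex_scope.

(* Vectors are functions on [I] of which only the values on a finite list [S]
   matter; a family is indexed by [nat] and only its first [K] members matter. *)
Definition ip S u v : R[i] := \sum_(n <- S) u n * cconj (v n).
Definition nrm2 S u : R := \sum_(n <- S) cabs (u n) ^+ 2.
Definition form S (t : I -> I -> R[i]) u v : R[i] :=
  \sum_(n <- S) \sum_(m <- S) u n * cconj (v m) * t n m.
Definition orthonormal_family S K q :=
  forall i j, (i < K)%N -> (j < K)%N -> ip S (q i) (q j) = (i == j)%:R.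
Definition supported S u := forall n, n \notin S -> u n = 0.
(* The projection of [u] off the span of [q 0, ..., q (K-1)]. *)
Definition compl S K q u : I -> R[i] :=
  fun n => u n - \sum_(i < K) ip S u (q i) * q i n.

Lemma nrm2_ge0 S u : 0 <= nrm2 S u.
Proof. by apply: sumr_ge0 => n _; rewrite sqr_ge0. Qed.

Lemma nrm2E S u : (nrm2 S u)%:C = ip S u u.
Proof. by rewrite realc_sum; apply: eq_bigr => n _; rewrite cabs_sqrC. Qed.

Lemma nrm2Z S (s : R) u : nrm2 S (fun n => s%:C * u n) = s ^+ 2 * nrm2 S u.
Proof.
rewrite /nrm2 mulr_sumr; apply: eq_bigr => n _.
by rewrite cabsM exprMn cabs_real real_normK ?num_real.
Qed.

Lemma nrm2_eq0 S u : nrm2 S u = 0 -> {in S, u =1 fun=> 0}.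
Proof.
move=> /eqP; rewrite psumr_eq0 => [/allP u0 n /u0/=|? _]; last by rewrite sqr_ge0.
by rewrite sqrf_eq0 cabs_normc => /eqP/Normc.eq0_normc.
Qed.

Lemma nrm2_normalize S u : 0 < nrm2 S u -> exists s : R, s ^+ 2 * nrm2 S u = 1.
Proof.
move=> u0; exists (Num.sqrt (nrm2 S u))^-1.
by rewrite exprVn sqr_sqrtr ?nrm2_ge0// mulVf// gt_eqF.
Qed.

Lemma ipJ S u v : cconj (ip S u v) = ip S v u.
Proof.
by rewrite cconj_sum; apply: eq_bigr => n _; rewrite cconjM cconjK mulrC.
Qed.

(** An arbitrary linear functional [al] is allowed, so that inner products and both slots of [form]
    are covered at once. *)
Lemma compl_linear S K q u (al : I -> R[i]) :
  \sum_(n <- S) compl S K q u n * al n =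
  \sum_(n <- S) u n * al n -
  \sum_(i < K) ip S u (q i) * \sum_(n <- S) q i n * al n.
Proof.
under eq_bigr do rewrite mulrBl.
rewrite sumrB; congr (_ - _).
under eq_bigr do rewrite mulr_suml.
rewrite exchange_big/=; apply: eq_bigr => i _.
by rewrite mulr_sumr; apply: eq_bigr => n _; rewrite mulrA.
Qed.

Lemma ip_compll S K q u v : ip S (compl S K q u) v =
  ip S u v - \sum_(i < K) ip S u (q i) * ip S (q i) v.
Proof. exact: (compl_linear _ _ _ _ (fun n => cconj (v n))). Qed.

Lemma compl_orth S K q u j : orthonormal_family S K q -> (j < K)%N ->
  ip S (compl S K q u) (q j) = 0.
Proof.
move=> oq jK; rewrite ip_compll (bigD1 (Ordinal jK))//= oq// eqxx mulr1.
rewrite big1 ?addr0 ?subrr// => i /negbTE ij; rewrite oq//.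
by rewrite -(inj_eq val_inj) /= in ij; rewrite ij mulr0.
Qed.

(** Pythagoras: the projection is orthogonal to each [q i], so pairing it with itself leaves only
    its pairing with [u]. *)
Lemma nrm2_compl S K q u : orthonormal_family S K q ->
  nrm2 S (compl S K q u) = nrm2 S u - \sum_(i < K) cabs (ip S u (q i)) ^+ 2.
Proof.
move=> oq; apply: (@complexI R); rewrite realcB !nrm2E realc_sum.
rewrite ip_compll big1 ?subr0; last first.
  by move=> i _; rewrite -[ip S (q i) _]ipJ compl_orth// cconj0 mulr0.
rewrite -ipJ ip_compll cconjB ipJ cconj_sum; congr (_ - _).
by apply: eq_bigr => i _; rewrite cabs_sqrC cconjM !ipJ mulrC.
Qed.

Lemma nrm2_compl_le S K q u : orthonormal_family S K q ->
  nrm2 S (compl S K q u) <= nrm2 S u.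
Proof.
move=> oq; rewrite nrm2_compl// gerBl sumr_ge0// => i _.
by rewrite sqr_ge0.
Qed.

(** Bessel's inequality for [cconj k], written without the conjugate because [hs_sum] pairs its
    kernel with vectors bilinearly. *)
Lemma bessel S K q (k : I -> R[i]) : orthonormal_family S K q ->
  \sum_(i < K) cabs (\sum_(n <- S) k n * q i n) ^+ 2 <= nrm2 S k.
Proof.
move=> oq; have := nrm2_ge0 S (compl S K q (fun n => cconj (k n))).
rewrite nrm2_compl// subr_ge0.
under eq_bigr => i _.
  rewrite -cabsJ /ip cconj_sum.
  under [X in cabs X]eq_bigr do rewrite cconjM !cconjK.
  over.
by rewrite /nrm2; under [X in _ <= X]eq_bigr do rewrite cabsJ.
Qed.

Lemma ip_extend S S1 u v : uniq S -> uniq S1 -> {subset S <= S1} ->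
  supported S u \/ supported S v -> ip S1 u v = ip S u v.
Proof.
move=> uS uS1 SS1 uv; apply: big_extend => // n nS.
by case: uv => ->//; rewrite ?mul0r ?cconj0 ?mulr0.
Qed.

Lemma orthonormal_extend S S1 K q : uniq S -> uniq S1 -> {subset S <= S1} ->
  (forall i, (i < K)%N -> supported S (q i)) ->
  orthonormal_family S K q -> orthonormal_family S1 K q.
Proof.
by move=> uS uS1 SS1 sq oq i j iK jK; rewrite (@ip_extend S)// ?oq//; left; apply: sq.
Qed.

Lemma formE S t u v :
  form S t u v = \sum_(n <- S) u n * \sum_(m <- S) cconj (v m) * t n m.
Proof.
apply: eq_bigr => n _; rewrite mulr_sumr; apply: eq_bigr => m _.
by rewrite mulrA.
Qed.

Lemma form_swap S t u v :
  form S t u v = \sum_(m <- S) cconj (v m) * \sum_(n <- S) u n * t n m.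
Proof.
rewrite /form exchange_big; apply: eq_bigr => m _; rewrite mulr_sumr.
by apply: eq_bigr => n _; rewrite mulrCA mulrA.
Qed.

Lemma form_compll S t K q u v :
  form S t (compl S K q u) v =
  form S t u v - \sum_(i < K) ip S u (q i) * form S t (q i) v.
Proof.
rewrite !formE compl_linear; congr (_ - _).
by apply: eq_bigr => i _; rewrite formE.
Qed.

Lemma form_complr S t K q u v :
  form S t u (compl S K q v) =
  form S t u v - \sum_(i < K) cconj (ip S v (q i)) * form S t u (q i).
Proof.
have fJ w : form S t u w =
    cconj (\sum_(m <- S) w m * cconj (\sum_(n <- S) u n * t n m)).
  rewrite form_swap cconj_sum; apply: eq_bigr => m _.
  by rewrite cconjM cconjK.
rewrite !fJ compl_linear cconjB; congr (_ - _); rewrite cconj_sum.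
by apply: eq_bigr => i _; rewrite cconjM fJ.
Qed.

(** Same shape as [sqsum], so that such vectors are admissible in [sing_val]. *)
Definition l2bounded (al : I -> R[i]) :=
  exists B : R, forall S, uniq S -> nrm2 S al <= B.

Lemma nrm2_sub S S1 u : uniq S -> uniq S1 -> {subset S <= S1} ->
  nrm2 S u <= nrm2 S1 u.
Proof.
move=> uS uS1 SS1.
rewrite [X in _ <= X](bigID (fun n => n \in S))/= -[X in _ <= X + _]big_filter.
rewrite [X in _ <= X + _](_ : _ = nrm2 S u).
  by rewrite lerDl sumr_ge0// => n _; rewrite sqr_ge0.
apply: perm_big; apply: uniq_perm => //; first exact: filter_uniq.
by move=> n; rewrite mem_filter; apply/andb_idr; exact: SS1.
Qed.

Lemma nrm2_extend S S1 u : uniq S -> uniq S1 -> {subset S <= S1} ->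
  supported S u -> nrm2 S1 u = nrm2 S u.
Proof.
move=> uS uS1 SS1 su; apply: big_extend => // n /su ->.
by rewrite cabs0 expr0n.
Qed.

Lemma l2bounded_supported S u : uniq S -> supported S u -> l2bounded u.
Proof.
move=> uS su; exists (nrm2 S u) => S1 uS1.
rewrite -(@nrm2_extend S (undup (S ++ S1)))// ?undup_uniq//; last first.
  by move=> n nS; rewrite mem_undup mem_cat nS.
apply: nrm2_sub; rewrite ?undup_uniq// => n nS.
by rewrite mem_undup mem_cat nS orbT.
Qed.

(** The idea is that of the Riesz theorem. The inhomogeneous bound [1 + nrm2] is the one that an
    estimate of the shape [Psi u + Psi v] supplies. *)
Lemma l2bounded_functional (S0 : seq I) (B : R) (al : I -> R[i]) : 0 < B ->
  (forall S, uniq S -> {subset S0 <= S} -> forall u,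
     cabs (\sum_(n <- S) u n * al n) <= B * (1 + nrm2 S u)) ->
  l2bounded al.
Proof.
move=> B0 hal; exists (4 * B ^+ 2) => S uS.
set S1 := undup (S0 ++ S).
have uS1 : uniq S1 by exact: undup_uniq.
apply: (@le_trans _ _ (nrm2 S1 al)).
  by apply: nrm2_sub => // n nS; rewrite mem_undup mem_cat nS orbT.
(* Test the functional on [u = s * conj al] and optimise in [s]. *)
pose s := (2 * B)^-1.
have s0 : 0 < s by rewrite invr_gt0 mulr_gt0.
have := hal S1 uS1 _ (fun n => s%:C * cconj (al n)).
have -> : \sum_(n <- S1) s%:C * cconj (al n) * al n = (s * nrm2 S1 al)%:C.
  rewrite realcM nrm2E mulr_sumr; apply: eq_bigr => n _.
  by rewrite -mulrA [cconj _ * _]mulrC.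
have -> : nrm2 S1 (fun n => s%:C * cconj (al n)) = s ^+ 2 * nrm2 S1 al.
  by rewrite nrm2Z; congr (_ * _); apply: eq_bigr => n _; rewrite cabsJ.
move=> H; have {H} : s * nrm2 S1 al <= B * (1 + s ^+ 2 * nrm2 S1 al).
  rewrite -[X in X <= _]ger0_norm -?cabs_real; last first.
    by rewrite mulr_ge0 ?nrm2_ge0// ltW.
  by apply: H => n nS; rewrite mem_undup mem_cat nS.
have Bs : B * s = 2^-1 by rewrite /s invfM mulrCA mulfV ?mulr1// gt_eqF.
move: (nrm2 S1 al) => X H.
(* With [B * s = 1/2] the inequality times [B] reads [X/2 <= B^2 + X/4], and the last term is
   absorbed. *)
have {H} : 2^-1 * X <= 2 * B ^+ 2 .
  have := ler_wpM2l (ltW B0) H.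
  rewrite (_ : B * (s * X) = 2^-1 * X); last by rewrite mulrA Bs.
  rewrite (_ : B * (B * (1 + s ^+ 2 * X)) = B ^+ 2 + (B * s) ^+ 2 * X); last by ring.
  by rewrite Bs; lra.
by lra.
Qed.

End FiniteHilbert.

(** * Finite rank approximation of a sesquilinear form *)

Section FiniteRank.
Variables (R : realType) (I : eqType).
Implicit Types (S : seq I) (u v : I -> R[i]) (q : nat -> I -> R[i]).
Local Open Scope complex_scope.

Lemma orthonormal_nrm2 S K q i : orthonormal_family S K q -> (i < K)%N ->
  nrm2 S (q i) = 1.
Proof. by move=> oq iK; apply: (@complexI R); rewrite nrm2E oq// eqxx. Qed.

(* Both sums on the right have rank at most [K]. *)
Lemma form_compl2 S t K q u v :
  form S t u v - form S t (compl S K q u) (compl S K q v) =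
  \sum_(j < K) ip S u (q j) * form S t (q j) v +
  \sum_(j < K) cconj (ip S v (q j)) * form S t (compl S K q u) (q j).
Proof. by rewrite form_complr form_compll; ring. Qed.

Variables (t : I -> I -> R[i]) (Psi : seq I -> (I -> R[i]) -> R) (B : R).
Hypothesis B0 : 0 < B.
Hypothesis form_le : forall S, uniq S -> forall u v,
  cabs (form S t u v) <= Psi S u + Psi S v.
Hypothesis Psi_le : forall S, uniq S -> forall u, Psi S u <= B * nrm2 S u.
Variables (K : nat) (S0 : seq I) (q : nat -> I -> R[i]) (eps : R).
Hypothesis uS0 : uniq S0.
Hypothesis sq : forall i, (i < K)%N -> supported S0 (q i).
Hypothesis oq : orthonormal_family S0 K q.
Hypothesis eps0 : 0 <= eps.
Hypothesis Psi_small : forall S, uniq S -> {subset S0 <= S} -> forall u,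
  (forall i, (i < K)%N -> ip S u (q i) = 0) -> Psi S u <= eps * nrm2 S u.

Let oqS S : uniq S -> {subset S0 <= S} -> orthonormal_family S K q.
Proof. by move=> uS SS; apply: (orthonormal_extend _ _ _ sq oq). Qed.

(** [bcoef j] and [acoef j] represent the functionals [v |-> form (q j) v] and
    [u |-> form (compl u) (q j)]; sums over [S0] suffice because the [q j] are supported there. *)
Let bcoef j m := \sum_(n <- S0) q j n * t n m.
Let acoef j n := cconj (\sum_(m <- S0) cconj (q j m) * t n m -
  \sum_(i < K) cconj (q i n) * form S0 t (q i) (q j)).

Let bcoefE S j : uniq S -> {subset S0 <= S} -> (j < K)%N -> forall v,
  \sum_(m <- S) cconj (v m) * bcoef j m = form S t (q j) v.
Proof.
move=> uS SS jK v; rewrite form_swap; apply: eq_bigr => m _; congr (_ * _).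
rewrite (@big_extend _ _ S0 S)// => n nS.
by rewrite (sq jK nS) mul0r.
Qed.

Let form_ext S i j : uniq S -> {subset S0 <= S} -> (i < K)%N -> (j < K)%N ->
  form S t (q i) (q j) = form S0 t (q i) (q j).
Proof.
move=> uS SS iK jK; rewrite !formE (@big_extend _ _ S0 S)//; last first.
  by move=> n nS; rewrite (sq iK nS) mul0r.
apply: eq_bigr => n _; congr (_ * _).
by rewrite (@big_extend _ _ S0 S)// => m mS; rewrite (sq jK mS) cconj0 mul0r.
Qed.

Let acoefE S j : uniq S -> {subset S0 <= S} -> (j < K)%N -> forall u,
  ip S u (acoef j) = form S t (compl S K q u) (q j).
Proof.
move=> uS SS jK u; rewrite form_compll formE /ip.
under eq_bigr do rewrite /acoef cconjK mulrBr.
rewrite sumrB; congr (_ - _).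
  apply: eq_bigr => n _; congr (_ * _).
  by rewrite (@big_extend _ _ S0 S)// => m mS; rewrite (sq jK mS) cconj0 mul0r.
under eq_bigr do rewrite mulr_sumr.
rewrite exchange_big/=; apply: eq_bigr => i _.
rewrite form_ext// /ip mulr_suml; apply: eq_bigr => n _.
by rewrite mulrA.
Qed.

(** Freezing one slot at the unit vector [q j] turns the form bound into [B + B * nrm2], as
    [l2bounded_functional] expects. *)
Let bcoef_l2 j : (j < K)%N -> l2bounded (bcoef j).
Proof.
move=> jK; apply: (@l2bounded_functional _ _ S0 B) => // S uS SS u.
rewrite (_ : \sum_(n <- S) _ = form S t (q j) (fun n => cconj (u n))); last first.
  by rewrite -bcoefE//; apply: eq_bigr => n _; rewrite cconjK.
apply: (le_trans (form_le uS _ _)); rewrite mulrDr mulr1.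
apply: lerD.
  by rewrite (le_trans (Psi_le uS _))// (orthonormal_nrm2 (oqS uS SS) jK) mulr1.
rewrite (le_trans (Psi_le uS _))// ler_wpM2l ?(ltW B0)//.
by rewrite /nrm2; under eq_bigr do rewrite cabsJ.
Qed.

Let l2bounded_conj (al : I -> R[i]) :
  l2bounded (fun n => cconj (al n)) -> l2bounded al.
Proof.
move=> [C hC]; exists C => S /hC; congr (_ <= _).
by apply: eq_bigr => n _; rewrite cabsJ.
Qed.

Let acoef_l2 j : (j < K)%N -> l2bounded (acoef j).
Proof.
move=> jK; apply: l2bounded_conj.
apply: (@l2bounded_functional _ _ S0 B) => // S uS SS u.
rewrite -/(ip S u (acoef j)) acoefE//.
apply: (le_trans (form_le uS _ _)); rewrite mulrDr mulr1 addrC.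
apply: lerD.
  by rewrite (le_trans (Psi_le uS _))// (orthonormal_nrm2 (oqS uS SS) jK) mulr1.
rewrite (le_trans (Psi_le uS _))// ler_wpM2l ?(ltW B0)//.
by apply: nrm2_compl_le; exact: oqS.
Qed.

(** Compressing the form to the complement of the [q i] in both slots changes it by rank at most
    [K + K]; on the compression [form_le] and [Psi_small] cost [eps] for each slot. *)
Lemma finite_rank_approx k : (K + K <= k)%N ->
  exists a b : 'I_k -> I -> R[i],
  (forall j, l2bounded (a j) /\ l2bounded (b j)) /\
  forall S c S' c', uniq S -> uniq S' -> nrm2 S c <= 1 -> nrm2 S' c' <= 1 ->
  cabs (\sum_(n <- S) \sum_(m <- S') c n * cconj (c' m) * t n m -
        \sum_(j < k) ip S c (a j) * cconj (ip S' c' (b j))) <= eps + eps.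
Proof.
move=> Kk.
(* The first [K] slots hold the terms with [<u, q j>], the next [K] those with [<v, q j>], and spare
   slots are filled with [0]. *)
pose a (j : 'I_k) :=
  if (j < K)%N then q j else if (j < K + K)%N then acoef (j - K) else 0.
pose b (j : 'I_k) :=
  if (j < K)%N then bcoef j else if (j < K + K)%N then q (j - K)%N else 0.
have l20 : l2bounded (0 : I -> R[i]).
  by exists 0 => S uS; rewrite /nrm2 big1// => n _; rewrite cabs0 expr0n.
exists a, b; split.
  move=> j; rewrite /a /b; case: ifPn => jK.
    by split; [exact: (l2bounded_supported uS0 (sq jK))|exact: bcoef_l2].
  case: ifPn => // jKK; have jK' : (j - K < K)%N by lia.
  by split; [exact: acoef_l2|exact: (l2bounded_supported uS0 (sq jK'))].
move=> S c S' c' uS uS' c1 c'1.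
(* One list carries both vectors, extended by zero, and contains [S0], as [form] and [Psi_small]
   require. *)
pose S1 := undup (S0 ++ S ++ S').
have uS1 : uniq S1 by exact: undup_uniq.
have S01 : {subset S0 <= S1} by move=> n nS; rewrite mem_undup !mem_cat nS.
have SS1 : {subset S <= S1} by move=> n nS; rewrite mem_undup !mem_cat nS orbT.
have SS'1 : {subset S' <= S1} by move=> n nS; rewrite mem_undup !mem_cat nS !orbT.
pose ext (T : seq I) (w : I -> R[i]) n := if n \in T then w n else 0.
have ext0 T w n : n \notin T -> ext T w n = 0 by rewrite /ext => /negbTE ->.
have extE T w n : n \in T -> ext T w n = w n by rewrite /ext => ->.
pose u := ext S c; pose v := ext S' c'.
have nu : nrm2 S1 u = nrm2 S c.
  rewrite (nrm2_extend uS)//; last by move=> n nS; exact: ext0.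
  rewrite /u; apply: eq_big_seq => n nS /=; rewrite extE//.
have nv : nrm2 S1 v = nrm2 S' c'.
  rewrite (nrm2_extend uS')//; last by move=> n nS; exact: ext0.
  rewrite /v; apply: eq_big_seq => n nS /=; rewrite extE//.
have ipu w : ip S c w = ip S1 u w.
  rewrite (@ip_extend _ _ S S1)//; last by left => n nS; exact: ext0.
  rewrite /u; apply: eq_big_seq => n nS /=; rewrite extE//.
have ipv w : ip S' c' w = ip S1 v w.
  rewrite (@ip_extend _ _ S' S1)//; last by left => n nS; exact: ext0.
  rewrite /v; apply: eq_big_seq => n nS /=; rewrite extE//.
have -> : \sum_(n <- S) \sum_(m <- S') c n * cconj (c' m) * t n m = form S1 t u v.
  rewrite formE (@big_extend _ _ S S1)//; last first.
    by move=> n nS; rewrite /u ext0// mul0r.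
  apply: eq_big_seq => n nS; rewrite (@big_extend _ _ S' S1)//; last first.
    by move=> m mS; rewrite /v ext0// cconj0 mul0r.
  rewrite mulr_sumr; apply: eq_big_seq => m mS.
  by rewrite /u /v !extE// mulrA.
under [X in _ - X]eq_bigr do rewrite ipu ipv.
have -> : \sum_(j < k) ip S1 u (a j) * cconj (ip S1 v (b j)) =
    form S1 t u v - form S1 t (compl S1 K q u) (compl S1 K q v).
  rewrite form_compl2.
  pose a' (j : nat) :=
    if (j < K)%N then q j else if (j < K + K)%N then acoef (j - K) else 0.
  pose b' (j : nat) :=
    if (j < K)%N then bcoef j else if (j < K + K)%N then q (j - K)%N else 0.
  rewrite -(big_mkord xpredT (fun j => ip S1 u (a' j) * cconj (ip S1 v (b' j)))).
  rewrite (@big_cat_nat _ _ _ (K + K))//= [X in _ + X]big_nat_cond.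
  rewrite [X in _ + X]big1 ?addr0; last first.
    move=> j /andP[/andP[jK _] _].
    rewrite /a' /b' !ltnNge jK /= (leq_trans (leq_addr _ _) jK)/=.
    by rewrite [ip S1 v _]big1 ?cconj0 ?mulr0// => n _; rewrite cconj0 mulr0.
  rewrite (@big_cat_nat _ _ _ K)//= ?leq_addr//; congr (_ + _).
    rewrite big_mkord; apply: eq_bigr => j _; rewrite /a' /b' ltn_ord; congr (_ * _).
    rewrite -bcoefE// /ip cconj_sum; apply: eq_bigr => m _.
    by rewrite cconjM cconjK.
  rewrite -[X in \sum_(X <= _ < _) _]add0n big_addn addnK big_mkord.
  apply: eq_bigr => j _; rewrite /a' /b' addnK ltnNge leq_addl/= ltn_add2r ltn_ord.
  by rewrite acoefE// mulrC.
rewrite opprB addrC subrK.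
apply: (le_trans (form_le uS1 _ _)); apply: lerD.
  apply: (le_trans (Psi_small uS1 S01 _)) => [i iK|].
    by rewrite compl_orth//; exact: oqS.
  by rewrite ler_piMr// (le_trans (nrm2_compl_le _ (oqS uS1 S01)))// nu.
apply: (le_trans (Psi_small uS1 S01 _)) => [i iK|].
    by rewrite compl_orth//; exact: oqS.
by rewrite ler_piMr// (le_trans (nrm2_compl_le _ (oqS uS1 S01)))// nv.
Qed.

End FiniteRank.

(** * Greedy choice of an orthonormal family *)

Section Greedy.
Variables (R : realType) (I : eqType).
Implicit Types (S : seq I) (u v : I -> R[i]) (q : nat -> I -> R[i]).
Local Open Scope complex_scope.

Variables (Phi : seq I -> (I -> R[i]) -> R) (C delta : R).
Hypothesis Phi_ge0 : forall S u, 0 <= Phi S u.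
Hypothesis PhiZ : forall S (s : R) u, Phi S (fun n => s%:C * u n) = s ^+ 2 * Phi S u.
Hypothesis Phi_ext : forall S S1 u, uniq S -> uniq S1 -> {subset S <= S1} ->
  supported S u -> Phi S1 u = Phi S u.
Hypothesis Phi_eq : forall S u v, {in S, u =1 v} -> Phi S u = Phi S v.
Hypothesis Phi_sum : forall S K q, uniq S -> orthonormal_family S K q ->
  \sum_(i < K) Phi S (q i) <= C.

Let Phi_eq0 S u : nrm2 S u = 0 -> Phi S u = 0.
Proof.
move=> /nrm2_eq0 u0; rewrite (@Phi_eq _ _ (fun n => (0 : R)%:C * u n)).
  by rewrite PhiZ expr0n mul0r.
by move=> n nS; rewrite u0// mulr0.
Qed.

(** A unit vector alone is an orthonormal family, so the trace bound [C] dominates [Phi] on the unit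
    sphere. *)
Lemma summable_form_bounded S u : uniq S -> Phi S u <= C * nrm2 S u.
Proof.
move=> uS; have [u0|u0] := leP (nrm2 S u) 0.
  have nu0 : nrm2 S u = 0 by apply/eqP; rewrite eq_le u0 nrm2_ge0.
  by rewrite nu0 mulr0 Phi_eq0.
have [s s2] := nrm2_normalize u0.
have o1 : orthonormal_family S 1 (fun=> fun n => s%:C * u n).
  by move=> [|//] [|//] _ _; rewrite -nrm2E nrm2Z s2.
have := Phi_sum uS o1; rewrite big_ord1 PhiZ => h.
rewrite -[leLHS]mulr1 -s2 mulrA [Phi _ _ * _]mulrC.
by rewrite ler_wpM2r// nrm2_ge0.
Qed.

Hypothesis delta0 : 0 < delta.
Variables (S0 : seq I) (K0 : nat) (q0 : nat -> I -> R[i]).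
Hypothesis uS0 : uniq S0.
Hypothesis sq0 : forall i, (i < K0)%N -> supported S0 (q0 i).
Hypothesis oq0 : orthonormal_family S0 K0 q0.

(** The state after [m] greedy steps. The prescribed segment [q0] carries no lower bound on [Phi];
    only the later vectors are counted against [C]. *)
Let good m S q := [/\ uniq S /\ {subset S0 <= S},
  forall i, (i < K0 + m)%N -> supported S (q i),
  orthonormal_family S (K0 + m) q,
  forall i, (i < K0)%N -> q i = q0 i &
  forall i, (K0 <= i < K0 + m)%N -> delta <= Phi S (q i)].

Let maximal m S q := forall S1, uniq S1 -> {subset S <= S1} ->
  forall u, (forall i, (i < K0 + m)%N -> ip S1 u (q i) = 0) ->
  Phi S1 u <= delta * nrm2 S1 u.

Let good_bound m S q : good m S q -> delta * m%:R <= C.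
Proof.
move=> [[uS _] _ oq _ dq]; apply: (le_trans _ (Phi_sum uS oq)).
rewrite big_split_ord/= -[X in X <= _]add0r lerD//.
  by apply: sumr_ge0 => i _; exact: Phi_ge0.
rewrite mulr_natr -[X in _ *+ X]card_ord -sumr_const ler_sum// => i _.
by apply: dq; rewrite leq_addr ltn_add2l ltn_ord.
Qed.

(** Failure of maximality yields a vector orthogonal to the family with [Phi > delta * nrm2]; cut
    off to [S1] and normalised, it is the next member. *)
Let good_extend m S q : good m S q -> ~ maximal m S q ->
  exists S1 q1, good m.+1 S1 q1.
Proof.
move=> [[uS S0S] sq oq qq0 dq] /existsNP[S1] /not_implyP[uS1] /not_implyP[SS1].
move=> /existsNP[u] /not_implyP[uq] /negP; rewrite -ltNge => dPhi.
have oq1 := orthonormal_extend uS uS1 SS1 sq oq.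
pose su n := if n \in S1 then u n else 0.
have suE : {in S1, su =1 u} by move=> n nS; rewrite /su nS.
have ipu v : ip S1 su v = ip S1 u v.
  by apply: eq_big_seq => n nS; rewrite suE.
have nu : nrm2 S1 u = nrm2 S1 su.
  by apply: eq_big_seq => n nS; rewrite suE.
have Phiu : Phi S1 u = Phi S1 su by apply: Phi_eq => n nS; rewrite suE.
rewrite nu Phiu in dPhi.
have [n0|n0] := leP (nrm2 S1 su) 0.
  have nu0 : nrm2 S1 su = 0 by apply/eqP; rewrite eq_le n0 nrm2_ge0.
  by move: dPhi; rewrite nu0 mulr0 Phi_eq0// ltxx.
have [s s2] := nrm2_normalize n0.
pose w n := s%:C * su n.
have ipw v : ip S1 w v = s%:C * ip S1 u v.
  by rewrite -ipu /ip mulr_sumr; apply: eq_bigr => n _; rewrite mulrA.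
have nw : ip S1 w w = 1.
  by rewrite -nrm2E nrm2Z s2.
pose q1 i := if (i < K0 + m)%N then q i else w.
have q1E i : (i < K0 + m)%N -> q1 i = q i by rewrite /q1 => ->.
have q1w : q1 (K0 + m)%N = w by rewrite /q1 ltnn.
have ltS i : (i < K0 + m.+1)%N -> (i < K0 + m)%N \/ i = (K0 + m)%N.
  by rewrite addnS ltnS leq_eqVlt => /orP[/eqP|]; [right|left].
exists S1, q1; split.
- by split=> // n nS; apply/SS1/S0S.
- move=> i /ltS[im|->].
    by rewrite q1E// => n nS; apply: sq => //; apply: contra nS; exact: SS1.
  by rewrite q1w => n nS; rewrite /w /su (negbTE nS) mulr0.
- move=> i j /ltS[im|->] /ltS[jm|->].
  + by rewrite !q1E// oq1.
  + rewrite (q1E _ im) q1w -ipJ ipw uq// mulr0 cconj0.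
    by rewrite (ltn_eqF im).
  + rewrite (q1E _ jm) q1w ipw uq// mulr0.
    by rewrite (gtn_eqF jm).
  + by rewrite q1w nw eqxx.
- by move=> i iK0; rewrite q1E ?qq0// ltn_addr.
- move=> i /andP[K0i /ltS[im|->]].
    rewrite q1E// (Phi_ext uS uS1 SS1 (sq _ im)).
    by apply: dq; rewrite K0i.
  rewrite q1w PhiZ -[leLHS]mulr1 -s2 mulrCA ler_wpM2l ?sqr_ge0//.
  exact: ltW.
Qed.

Let good0 : good 0 S0 q0.
Proof.
split; rewrite ?addn0//; first by split.
by move=> i /andP[/leq_ltn_trans h /h]; rewrite ltnn.
Qed.

Let good_or_maximal m : (exists S q, good m S q) \/
  (exists m' S q, good m' S q /\ maximal m' S q).
Proof.
elim: m => [|m [[S [q g]]|]]; [by left; exists S0, q0| |by right].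
have [mx|nmx] := EM (maximal m S q); first by right; exists m, S, q.
by left; exact: good_extend g nmx.
Qed.

(* Stands in for the singular value decomposition of a Hilbert-Schmidt operator:
   a maximal orthonormal family on whose new members [Phi >= delta]. *)
Lemma greedy_orthonormal : exists m S q,
  [/\ uniq S /\ {subset S0 <= S}, delta * m%:R <= C,
    (forall i, (i < K0 + m)%N -> supported S (q i)) /\
      orthonormal_family S (K0 + m) q,
    forall i, (i < K0)%N -> q i = q0 i &
    forall S1, uniq S1 -> {subset S <= S1} ->
      forall u, (forall i, (i < K0 + m)%N -> ip S1 u (q i) = 0) ->
      Phi S1 u <= delta * nrm2 S1 u].
Proof.
(* Beyond [C / delta] steps [good_bound] fails, so the procedure must have met a maximal family
   before. *)
have [M CM] : exists M, C < delta * M%:R.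
  exists (Num.truncn (C / delta)).+1.
  by rewrite mulrC -ltr_pdivrMr// truncnS_gt.
have [[S [q /good_bound]]|[m [S [q [g mx]]]]] := good_or_maximal M.
  by rewrite leNgt CM.
have := good_bound g; case: g => uS sq oq qq0 _ dm.
by exists m, S, q; split.
Qed.

End Greedy.

(** A list in [P] that admits no new element exhausts [P], and the size bound makes the enlargement
    stop; [k] below is the fuel. *)
Lemma finite_pred_enum (I : eqType) (P : pred I) (b : nat) :
  (forall S : seq I, uniq S -> all P S -> (size S <= b)%N) ->
  exists S : seq I, uniq S /\ forall n, (n \in S) = P n.
Proof.
move=> hb.
suff H k (S : seq I) : uniq S -> all P S -> (b < size S + k)%N ->
    exists S : seq I, uniq S /\ forall n, (n \in S) = P n.
  by apply: (H b.+1 [::]).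
elim: k S => [|k IH] S uS PS bS.
  by have := hb S uS PS; rewrite leqNgt -[size S]addn0 bS.
have [[n [Pn nS]]|nex] := EM (exists n, P n /\ n \notin S).
  apply: (IH (n :: S)) => /=; [by rewrite nS|by rewrite Pn|].
  by rewrite addSnnS.
exists S; split=> // n; apply/idP/idP => [/(allP PS)//|Pn].
by apply: contrapT => /negP nS; apply: nex; exists n.
Qed.

(** * Counting lattice points by frequency shells *)

Section FrequencyShells.
Variables (R : realType) (d : nat).
Implicit Types (n : d.-tuple int) (S : seq (d.-tuple int)) (N M : R).

(** This is the inverse square of [wgt n]. The exponent [d / 2] makes the number of frequencies with
    [freq n <= M] at most linear in [M] in every dimension. *)
Definition freq n : R := powR (1 + nsq n) (d%:R / 2).

Lemma nsq_ge0 n : 0 <= nsq n :> R.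
Proof. by apply: sumr_ge0 => i _; rewrite sqr_ge0. Qed.

Lemma freq_ge1 n : 1 <= freq n.
Proof.
have <- : powR 1 (d%:R / 2) = 1 :> R by rewrite powR1.
rewrite /freq ge0_ler_powR ?nnegrE//.
- by rewrite addr_ge0// nsq_ge0.
- by rewrite lerDl nsq_ge0.
Qed.

Lemma freq_gt0 n : 0 < freq n.
Proof. exact: lt_le_trans (freq_ge1 n). Qed.

Lemma wgt_ge0 n : 0 <= wgt n :> R.
Proof. exact: powR_ge0. Qed.

Lemma wgt_sqr n : wgt n ^+ 2 = (freq n)^-1.
Proof.
rewrite -powR_mulrn ?wgt_ge0// /wgt -powRrM /freq -powRN.
by congr (powR _ _); rewrite mulNr; congr (- _); field.
Qed.

Lemma coord_le_freq n (i : 'I_d) : `|tnth n i|%:R ^+ d <= freq n.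
Proof.
have a0 : 0 <= `|tnth n i|%:R :> R by [].
rewrite -powR_mulrn// (_ : d%:R = 2 * (d%:R / 2)); last by field.
rewrite powRrM powR_mulrn// /freq ge0_ler_powR ?nnegrE ?sqr_ge0//.
  by rewrite addr_ge0// nsq_ge0.
rewrite /nsq (bigD1 i)//= natr_absz intr_norm real_normK ?num_real//.
rewrite addrCA lerDl addr_ge0// sumr_ge0// => j _; exact: sqr_ge0.
Qed.

Lemma box_count m S : uniq S ->
  (forall n, n \in S -> forall i, (`|tnth n i| <= m)%N) ->
  (size S <= (m.*2.+1) ^ d)%N.
Proof.
move=> uS Sm.
(* Shifting by [m] sends [[-m, m]] to [[0, 2m]], where [inord] is faithful. *)
pose g (x : int) : 'I_(m.*2.+1) := inord `|(x + m%:Z)%R|.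
pose f n : d.-tuple 'I_(m.*2.+1) := [tuple g (tnth n i) | i < d].
have finj : {in S &, injective f}.
  move=> n n' nS n'S /(congr1 (fun t => tnth t _)) nn'.
  apply: eq_from_tnth => i; move: (nn' i); rewrite !tnth_mktuple.
  move: (Sm _ nS i) (Sm _ n'S i); move: (tnth n i) (tnth n' i) => x y xm ym.
  move=> /(congr1 val); rewrite /= !inordK; lia.
rewrite -(size_map f) -(card_uniqP _) ?map_inj_in_uniq//.
by rewrite (leq_trans (max_card _))// card_tuple card_ord.
Qed.

(** Coordinates are at most [M^(1/d)], so a cube of side [2m + 1 <= 3m] holds all of [S]. The
    absolute value covers an empty [S] with negative [M]. *)
Lemma freq_count M S : uniq S -> (forall n, n \in S -> freq n <= M) ->
  (size S)%:R <= 3 ^+ d * `|M|.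
Proof.
move=> uS SM; have [->|[n0 n0S]] : S = [::] \/ exists n, n \in S.
- by case: S {uS SM} => [|n S]; [left|right; exists n; rewrite mem_head].
- by rewrite mulr_ge0.
have M1 : 1 <= M := le_trans (freq_ge1 n0) (SM _ n0S).
rewrite ger0_norm ?(le_trans ler01)//.
pose r : R := powR M d%:R^-1; pose m := Num.truncn r.
have r1 : 1 <= r.
  have <- : powR 1 d%:R^-1 = 1 :> R by rewrite powR1.
  by rewrite ge0_ler_powR ?nnegrE ?invr_ge0// (le_trans ler01).
have m1 : (0 < m)%N by rewrite truncn_gt0.
have mr : m%:R <= r by rewrite truncn_le (le_trans ler01).
have rd : (0 < d)%N -> r ^+ d = M.
  move=> d0; rewrite -powR_mulrn ?powR_ge0// -powRrM mulVf ?powRr1//.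
    by rewrite (le_trans ler01).
  by rewrite pnatr_eq0 -lt0n.
have mM : m%:R ^+ d <= M.
  have [d0|d0] := posnP d; first by rewrite [X in _ ^+ X]d0.
  by rewrite -(rd d0) lerXn2r// nnegrE ?ler0n// (le_trans ler01).
apply: (@le_trans _ _ ((m.*2.+1) ^ d)%:R).
  rewrite ler_nat; apply: box_count => // n nS i.
  have d0 : (0 < d)%N by apply: leq_ltn_trans (ltn_ord i).
  rewrite truncn_ge_nat ?(le_trans ler01)//.
  rewrite -(@ler_pXn2r _ d)// ?nnegrE ?(le_trans ler01 r1)//.
  by rewrite rd// (le_trans (coord_le_freq n i))// SM.
apply: (@le_trans _ _ ((3 * m) ^ d)%:R).
  by rewrite !natrX lerXn2r ?nnegrE// ler_nat; lia.
by rewrite expnMn natrM !natrX ler_wpM2l.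
Qed.

Variable N : R.
Hypothesis N0 : 0 < N.

Lemma level_exists n : exists j : nat, freq n <= N * 4 ^+ j.
Proof.
exists (Num.truncn (freq n / N)).+1.
rewrite -ler_pdivrMl// mulrC (le_trans (ltW (truncnS_gt _)))//.
rewrite -natrX ler_nat; exact/ltnW/ltn_expl.
Qed.

(* [level n = 0] iff [freq n <= N]; otherwise [n] lies in the shell
   [N * 4 ^+ (level n).-1 < freq n <= N * 4 ^+ level n]. *)
Definition level n : nat := ex_minn (level_exists n).

Lemma level_ub n : freq n <= N * 4 ^+ level n.
Proof. by rewrite /level; case: ex_minnP. Qed.

Lemma level_lb n j : (j < level n)%N -> N * 4 ^+ j < freq n.
Proof.
rewrite /level; case: ex_minnP => m _ mmin jm; rewrite ltNge.
by apply/negP => /mmin; rewrite leqNgt jm.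
Qed.

Lemma low_count S : uniq S -> (forall n, n \in S -> level n = 0%N) ->
  (size S)%:R <= 3 ^+ d * N.
Proof.
move=> uS S0; rewrite -[in leRHS](ger0_norm (ltW N0)).
apply: freq_count => // n /S0 n0; have := level_ub n.
by rewrite n0 expr0 mulr1.
Qed.

(** There are at most [3^d * N * 4^(j+1)] frequencies, each of weight below [1 / (N * 4^j)]: [N]
    cancels, and [4] is the ratio of consecutive thresholds. *)
Lemma shell_sum S j : uniq S ->
  \sum_(n <- S | level n == j.+1) (freq n)^-1 <= 4 * 3 ^+ d.
Proof.
move=> uS; rewrite -big_filter; set S' := [seq _ <- S | _].
have uS' : uniq S' by exact: filter_uniq.
have S'j n : n \in S' -> level n = j.+1 by rewrite mem_filter => /andP[/eqP].
have N4 i : 0 < N * 4 ^+ i by rewrite mulr_gt0// exprn_gt0.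
apply: (@le_trans _ _ (\sum_(n <- S') (N * 4 ^+ j)^-1)).
  rewrite big_seq [leRHS]big_seq; apply: ler_sum => n nS'.
  by rewrite lef_pV2 ?posrE ?freq_gt0// ltW// level_lb// S'j.
rewrite big_const_seq count_predT iter_addr_0 -[leLHS]mulr_natl ler_pdivrMr//.
apply: (le_trans (freq_count uS' (M := N * 4 ^+ j.+1) _)).
  by move=> n nS'; rewrite -(S'j _ nS') level_ub.
rewrite ger0_norm ?(ltW (N4 _))// exprS le_eqVlt; apply/orP; left.
by apply/eqP; ring.
Qed.

(** Level [0] is left out, so only shells above [N] are counted and no [log N] appears. *)
Lemma levels_sum S k : uniq S ->
  \sum_(n <- S | (0 < level n <= k)%N) (freq n)^-1 <= 4 * 3 ^+ d * k%:R.
Proof.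
move=> uS; elim: k => [|k IH].
  by rewrite big_pred0 ?mulr0// => n; case: level.
rewrite (bigID (fun n => level n == k.+1))/= addrC -[k.+1%:R]natr1 mulrDr mulr1 lerD//.
  apply: le_trans IH; rewrite le_eqVlt; apply/orP; left; apply/eqP.
  apply: eq_bigl => n; lia.
apply: le_trans (shell_sum k uS); rewrite le_eqVlt; apply/orP; left; apply/eqP.
by apply: eq_bigl => n; lia.
Qed.

Lemma low_enum : exists S : seq (d.-tuple int),
  [/\ uniq S, (forall n, (n \in S) = (level n == 0)%N) & (size S)%:R <= 3 ^+ d * N].
Proof.
have [S uS PS|S [uS HS]] := @finite_pred_enum _ (fun n => level n == 0)%N
    (Num.truncn (3 ^+ d * N)).
  rewrite truncn_ge_nat ?mulr_ge0 ?(ltW N0)//; apply: low_count => // n nS.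
  by apply/eqP; exact: (allP PS).
by exists S; split=> //; apply: low_count => // n; rewrite HS => /eqP.
Qed.

End FrequencyShells.

(** * Haar measure on the torus *)

Section TorusMeasure.
Variable R : realType.
Local Open Scope ereal_scope.

Lemma Npi_lt_pi : (- pi < pi :> R)%R.
Proof. by have := @pi_gt0 R; lra. Qed.

Definition haar1 : probability (measurableTypeR R) R := uniform_prob Npi_lt_pi.

Definition tcons n (xt : measurableTypeR R * n.-tuple R) : n.+1.-tuple R :=
  cons_tuple xt.1 xt.2.

Lemma measurable_tcons n : measurable_fun setT (@tcons n).
Proof.
have mfst : measurable_fun setT (fst : measurableTypeR R * n.-tuple R -> R).
  exact: measurable_fst.
exact: (measurable_cons mfst measurable_snd).
Qed.

HB.instance Definition _ n :=
  isMeasurableFun.Build _ _ _ _ (@tcons n) (@measurable_tcons n).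

(** Built one coordinate at a time, to match the recursion of [tint]. *)
Fixpoint haar n : probability (n.-tuple R) R :=
  match n with
  | 0 => dirac [tuple]
  | m.+1 => distribution (haar1 \x haar m) (@tcons m)
  end.

Let measurable_cons_comp n (g : n.+1.-tuple R -> \bar R) :
  measurable_fun setT g -> measurable_fun setT (g \o @tcons n).
Proof. by move=> mg; exact: (measurableT_comp mg (@measurable_tcons n)). Qed.

Lemma haarS n (g : n.+1.-tuple R -> \bar R) : measurable_fun setT g ->
  (forall x, 0 <= g x) ->
  \int[haar n.+1]_x g x = \int[haar1]_x \int[haar n]_t g (cons_tuple x t).
Proof.
move=> mg g0; rewrite [LHS]ge0_integral_distribution//.
rewrite (fubini_tonelli1 _ (measurable_cons_comp mg)) => [|xt]; last exact: g0.
by [].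
Qed.

(** Turns the iterated integral of the statement into one against a measure: Tonelli, with [haar1]
    unfolded to normalised Lebesgue measure. *)
Lemma tint_haar n (g : n.-tuple R -> \bar R) : measurable_fun setT g ->
  (forall x, 0 <= g x) -> tint g = \int[haar n]_x g x.
Proof.
elim: n g => [|n IH] g mg g0.
  by rewrite /= integral_dirac// diracT mul1e.
rewrite haarS// /haar1 integral_uniform//; last 2 first.
- apply: (measurable_fun_fubini_tonelli_F _ (measurable_cons_comp mg)) => xt.
  exact: g0.
- by move=> x; apply: integral_ge0.
rewrite /= opprK [in RHS](_ : pi + pi = 2 * pi)%R; last by lra.
congr (_ * _); apply: eq_integral => x _; apply: IH => //.
exact: (measurableT_comp (measurable_cons_comp mg) (pair1_measurable x)).
Qed.

End TorusMeasure.

(** * Bounded measurable functions on a probability space *)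

Section BoundedMeasurable.
Context d (T : measurableType d) (R : realType) (P : probability T R).
Implicit Types f g : T -> R.

(** A ring of functions that are integrable for [P] and preserve integrability as multipliers; real
    and imaginary parts of trigonometric polynomials belong to it. *)
Definition bmeas f :=
  measurable_fun setT f /\ exists M : R, forall x, `|f x| <= M.

Lemma bmeas_cst (c : R) : bmeas (fun=> c).
Proof. by split; [exact: measurable_cst|exists `|c|]. Qed.

Lemma bmeasD f g : bmeas f -> bmeas g -> bmeas (fun x => f x + g x).
Proof.
move=> [mf [M fM]] [mg [M' gM]]; split; first exact: measurable_funD.
by exists (M + M') => x; rewrite (le_trans (ler_normD _ _))// lerD.
Qed.

Lemma bmeasM f g : bmeas f -> bmeas g -> bmeas (fun x => f x * g x).
Proof.
move=> [mf [M fM]] [mg [M' gM]]; split; first exact: measurable_funM.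
by exists (M * M') => x; rewrite normrM ler_pM.
Qed.

Lemma bmeasN f : bmeas f -> bmeas (fun x => - f x).
Proof.
move=> /(bmeasM (bmeas_cst (-1))).
by congr bmeas; apply/funext => x; rewrite mulN1r.
Qed.

Lemma bmeasB f g : bmeas f -> bmeas g -> bmeas (fun x => f x - g x).
Proof. by move=> bf bg; apply: bmeasD => //; exact: bmeasN. Qed.

Lemma bmeasX f k : bmeas f -> bmeas (fun x => f x ^+ k).
Proof.
move=> bf; elim: k => [|k IH]; first exact: bmeas_cst.
by under eq_fun do rewrite exprS; exact: bmeasM.
Qed.

Lemma bmeas_sum (J : Type) (r : seq J) (F : J -> T -> R) :
  (forall j, bmeas (F j)) -> bmeas (fun x => \sum_(j <- r) F j x).
Proof.
move=> bF; elim: r => [|j r IH].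
  by under eq_fun do rewrite big_nil; exact: bmeas_cst.
by under eq_fun do rewrite big_cons; exact: bmeasD.
Qed.

Definition rintegrable f := P.-integrable setT (EFin \o f).

Lemma rintegrableM f g : rintegrable f -> bmeas g ->
  rintegrable (fun x => f x * g x).
Proof.
move=> fi [mg [M gM]]; rewrite /rintegrable.
rewrite (_ : _ \o _ = ((EFin \o f) \* (EFin \o g))%E).
  apply: integrableMl => //; exists M; split; first exact: num_real.
  by move=> y My x _ /=; rewrite (le_trans (gM x))// ltW.
exact/funext.
Qed.

Lemma bmeas_rintegrable f : bmeas f -> rintegrable f.
Proof.
move=> [mf [M fM]]; apply: measurable_bounded_integrable => //.
  exact: (le_lt_trans (@probability_le1 _ _ _ P setT measurableT) (ltry 1)).
exists M; split; first exact: num_real.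
by move=> y My x _ /=; rewrite (le_trans (fM x))// ltW.
Qed.

Lemma rintegrableZ (c : R) f : rintegrable f -> rintegrable (fun x => c * f x).
Proof.
move=> fi; under eq_fun do rewrite mulrC.
exact: rintegrableM fi (bmeas_cst c).
Qed.

Lemma rintegrableD f g : rintegrable f -> rintegrable g ->
  rintegrable (fun x => f x + g x).
Proof. by move=> fi gi; exact: (integrableD measurableT fi gi). Qed.

Lemma rintegrable_sum (J : Type) (r : seq J) (F : J -> T -> R) :
  (forall j, rintegrable (F j)) -> rintegrable (fun x => \sum_(j <- r) F j x).
Proof.
move=> iF; rewrite /rintegrable.
rewrite (_ : _ \o _ = (fun x => \sum_(j <- r) (EFin \o F j) x)%E).
  by apply: integrable_sum => //= j _; exact: iF.
by apply/funext => x /=; rewrite sumEFin.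
Qed.

Lemma Rintegral_sum (J : Type) (r : seq J) (F : J -> T -> R) :
  (forall j, rintegrable (F j)) ->
  \int[P]_x (\sum_(j <- r) F j x) = \sum_(j <- r) \int[P]_x F j x.
Proof.
move=> iF; elim: r => [|j r IH].
  rewrite big_nil; under eq_Rintegral do rewrite big_nil.
  by rewrite Rintegral_cst// mul0r.
rewrite big_cons -IH -RintegralD//; [|exact: iF|exact: rintegrable_sum].
by under eq_Rintegral do rewrite big_cons.
Qed.

Lemma Rintegral_probability_cst (c : R) : \int[P]_x c = c.
Proof.
rewrite Rintegral_cst// -[RHS]mulr1; congr (_ * _).
by rewrite -[RHS]/(fine 1%E); congr fine; exact: probability_setT.
Qed.

Lemma Rintegral_EFin f : rintegrable f ->
  (\int[P]_x f x)%:E = (\int[P]_x (f x)%:E)%E.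
Proof. by move=> fi; rewrite fineK//; exact: integrable_fin_num. Qed.

End BoundedMeasurable.

(** * Vanishing means of nonconstant characters in one variable *)

Section FourierOrthogonality.
Variable R : realType.

Lemma Rintegral_haarS n (g : n.+1.-tuple R -> R) : bmeas g ->
  \int[haar R n.+1]_x g x = \int[haar1 R]_x \int[haar R n]_t g (cons_tuple x t).
Proof.
move=> bg; have [mg [M gM]] := bg.
have mgc : measurable_fun setT (g \o @tcons R n).
  exact: (measurableT_comp mg (@measurable_tcons R n)).
have bgc : bmeas (g \o @tcons R n) by split=> //; exists M => x; exact: gM.
rewrite /Rintegral [in LHS]integral_distribution//; last first.
- exact: (bmeas_rintegrable (haar1 R \x haar R n)%E bgc).
- exact/measurable_EFinP.
rewrite -(integral12_prod_meas1 (f := EFin \o (g \o @tcons R n))); last first.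
  exact: (bmeas_rintegrable (haar1 R \x haar R n)%E bgc).
congr fine; apply: eq_integral => x _; rewrite Rintegral_EFin//.
apply: bmeas_rintegrable; split; last by exists M => t; exact: gM.
exact: (measurableT_comp mgc (pair1_measurable x)).
Qed.

Lemma measurable_cosZ (k : int) :
  measurable_fun setT (fun x : R => cos (k%:~R * x)).
Proof.
apply: measurableT_comp; last exact: measurable_funM.
by apply: continuous_measurable_fun => x; exact: continuous_cos.
Qed.

Lemma measurable_sinZ (k : int) :
  measurable_fun setT (fun x : R => sin (k%:~R * x)).
Proof.
apply: measurableT_comp; last exact: measurable_funM.
by apply: continuous_measurable_fun => x; exact: continuous_sin.
Qed.

Lemma cos_norm_le1 (x : R) : `|cos x| <= 1.
Proof. by rewrite ler_norml cos_geN1 cos_le1. Qed.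

Lemma sin_norm_le1 (x : R) : `|sin x| <= 1.
Proof. by rewrite ler_norml sin_geN1 sin_le1. Qed.

Lemma bmeas_cosZ (k : int) :
  @bmeas _ (measurableTypeR R) R (fun x => cos (k%:~R * x)).
Proof. by split; [exact: measurable_cosZ|exists 1 => x; exact: cos_norm_le1]. Qed.

Lemma bmeas_sinZ (k : int) :
  @bmeas _ (measurableTypeR R) R (fun x => sin (k%:~R * x)).
Proof. by split; [exact: measurable_sinZ|exists 1 => x; exact: sin_norm_le1]. Qed.

Lemma sin_intpi (k : int) : sin (k%:~R * pi) = 0 :> R.
Proof.
have H m : sin (m%:R * pi) = 0 :> R.
  elim: m => [|m IH]; first by rewrite mul0r sin0.
  by rewrite -natr1 mulrDl mul1r sinDpi IH oppr0.
case: k => m; first exact: H.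
by rewrite NegzE mulrNz mulNr sinN H oppr0.
Qed.

(* [1 + f] rather than [f], because [integral_uniform] needs a nonnegative
   integrand. *)
Lemma Rintegral_haar1_eq0 (f F : R -> R) : continuous f ->
  (forall x, `|f x| <= 1) ->
  (forall x : R, is_derive x (1 : R) F (1 + f x)) -> F pi - F (- pi) = 2 * pi ->
  \int[haar1 R]_x f x = 0.
Proof.
move=> cf f1 dF FE.
have mf : measurable_fun setT f by exact: continuous_measurable_fun.
have bf : @bmeas _ (measurableTypeR R) R f by split=> //; exists 1.
have c1f : continuous (fun x => 1 + f x).
  by move=> x; apply: continuousD; [exact: cst_continuous|exact: cf].
have dFd x : derivable F x 1 by case: (dF x).
have FTC : (\int[@lebesgue_measure R]_(x in `[(- pi)%R, pi%R]) (1 + f x)%:E =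
    (F pi)%:E - (F (- pi))%:E)%E.
  apply: (@continuous_FTC2 _ _ F); first exact: Npi_lt_pi.
  - exact: continuous_subspaceT.
  - split.
    + by move=> x _.
    + apply: cvg_at_right_filter; apply: differentiable_continuous.
      exact/derivable1_diffP.
    + apply: cvg_at_left_filter; apply: differentiable_continuous.
      exact/derivable1_diffP.
  - by move=> x _; rewrite derive1E; case: (dF x).
have : \int[haar1 R]_x (1 + f x) = 1.
  rewrite /Rintegral integral_uniform.
  - rewrite FTC -EFinB FE -EFinM /= opprK.
    by rewrite (_ : pi + pi = 2 * pi);
      [rewrite mulVf// mulf_neq0// gt_eqF// pi_gt0|lra].
  - by apply/measurable_EFinP; exact: measurable_funD.
  - by move=> x; rewrite lee_fin; have := f1 x; rewrite ler_norml => /andP[]; lra.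
rewrite RintegralD//; last 2 first.
- exact: (@bmeas_rintegrable _ (measurableTypeR R) R (haar1 R) _ (bmeas_cst _ 1)).
- exact: (@bmeas_rintegrable _ (measurableTypeR R) R (haar1 R) _ bf).
by rewrite Rintegral_probability_cst; lra.
Qed.

Lemma Rintegral_haar1_cos (k : int) : k != 0 ->
  \int[haar1 R]_x cos (k%:~R * x) = 0.
Proof.
move=> k0; have k0' : (k%:~R : R) != 0 by rewrite intr_eq0.
apply: (@Rintegral_haar1_eq0 _ (fun x => x + k%:~R^-1 * sin (k%:~R * x))).
- move=> x; apply: (@continuous_comp R R R ( *%R k%:~R) cos x).
    exact: mulrl_continuous.
  exact: continuous_cos.
- by move=> x; exact: cos_norm_le1.
- move=> x; apply: is_deriveD.
  have d1 : is_derive x (1 : R) (fun x : R => k%:~R * x) k%:~R.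
    have := @is_deriveZ _ _ _ (@id R) k%:~R x 1 1 (is_derive_id _ _).
    by rewrite /GRing.scale/= mulr1.
  have d2 := @is_derive1_comp R sin (fun x => k%:~R * x) x _ _ (is_derive_sin _) d1.
  have := @is_deriveZ _ _ _ _ k%:~R^-1 x 1 _ d2.
  by rewrite /GRing.scale/= mulrCA mulVf// mulr1.
- by rewrite mulrN sinN sin_intpi; lra.
Qed.

Lemma Rintegral_haar1_sin (k : int) : k != 0 ->
  \int[haar1 R]_x sin (k%:~R * x) = 0.
Proof.
move=> k0; have k0' : (k%:~R : R) != 0 by rewrite intr_eq0.
apply: (@Rintegral_haar1_eq0 _ (fun x => x + (- k%:~R^-1) * cos (k%:~R * x))).
- move=> x; apply: (@continuous_comp R R R ( *%R k%:~R) sin x).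
    exact: mulrl_continuous.
  exact: continuous_sin.
- by move=> x; exact: sin_norm_le1.
- move=> x; apply: is_deriveD.
  have d1 : is_derive x (1 : R) (fun x : R => k%:~R * x) k%:~R.
    have := @is_deriveZ _ _ _ (@id R) k%:~R x 1 1 (is_derive_id _ _).
    by rewrite /GRing.scale/= mulr1.
  have d2 := @is_derive1_comp R cos (fun x => k%:~R * x) x _ _ (is_derive_cos _) d1.
  have := @is_deriveZ _ _ _ _ (- k%:~R^-1) x 1 _ d2.
  by rewrite /GRing.scale/= mulNr mulrCA mulVf// mulr1 opprK.
- by rewrite mulrN cosN; lra.
Qed.

End FourierOrthogonality.

(** * Plancherel identity for trigonometric polynomials *)

Section Plancherel.
Variable R : realType.

Lemma measurable_dotZ d (k : d.-tuple int) :
  measurable_fun setT (fun x : d.-tuple R => dotZ k x).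
Proof.
by apply: measurable_sum => i; apply: measurable_funM => //; exact: measurable_tnth.
Qed.

Lemma bmeas_cos_dotZ d (k : d.-tuple int) :
  bmeas (fun x : d.-tuple R => cos (dotZ k x)).
Proof.
split; last by exists 1 => x; exact: cos_norm_le1.
apply: measurableT_comp; last exact: measurable_dotZ.
by apply: continuous_measurable_fun => x; exact: continuous_cos.
Qed.

Lemma bmeas_sin_dotZ d (k : d.-tuple int) :
  bmeas (fun x : d.-tuple R => sin (dotZ k x)).
Proof.
split; last by exists 1 => x; exact: sin_norm_le1.
apply: measurableT_comp; last exact: measurable_dotZ.
by apply: continuous_measurable_fun => x; exact: continuous_sin.
Qed.

Lemma dotZ_cons n k0 (k : n.-tuple int) (x : R) (t : n.-tuple R) :
  dotZ (cons_tuple k0 k) (cons_tuple x t) = k0%:~R * x + dotZ k t.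
Proof.
rewrite /dotZ big_ord_recl; congr (_ + _).
by apply: eq_bigr => i _; rewrite !tnthS.
Qed.

(** Cosine and sine are treated together because the addition formulas in the first coordinate mix
    them. *)
Lemma Rintegral_char_eq0 d (k : d.-tuple int) : (exists i, tnth k i != 0) ->
  \int[haar R d]_x cos (dotZ k x) = 0 /\ \int[haar R d]_x sin (dotZ k x) = 0.
Proof.
elim: d k => [|n IH] k; first by case=> -[].
case/tupleP: k => k0 k [i ki].
rewrite (Rintegral_haarS (bmeas_cos_dotZ _)) (Rintegral_haarS (bmeas_sin_dotZ _)).
have ic := bmeas_rintegrable (haar R n) (bmeas_cos_dotZ k).
have is_ := bmeas_rintegrable (haar R n) (bmeas_sin_dotZ k).
have icZ a := bmeas_rintegrable (haar R n) (bmeasM (bmeas_cst _ a) (bmeas_cos_dotZ k)).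
have isZ a := bmeas_rintegrable (haar R n) (bmeasM (bmeas_cst _ a) (bmeas_sin_dotZ k)).
pose Ck := \int[haar R n]_x cos (dotZ k x); pose Sk := \int[haar R n]_x sin (dotZ k x).
have innc x : \int[haar R n]_t cos (dotZ (cons_tuple k0 k) (cons_tuple x t)) =
    Ck * cos (k0%:~R * x) - Sk * sin (k0%:~R * x).
  under eq_Rintegral do rewrite dotZ_cons cosD.
  rewrite RintegralB//; [|exact: icZ|exact: isZ].
  by rewrite RintegralZl// RintegralZl// mulrC [X in _ - X]mulrC.
have inns x : \int[haar R n]_t sin (dotZ (cons_tuple k0 k) (cons_tuple x t)) =
    Ck * sin (k0%:~R * x) + Sk * cos (k0%:~R * x).
  under eq_Rintegral do rewrite dotZ_cons sinD.
  rewrite RintegralD//; [|exact: icZ|exact: isZ].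
  by rewrite RintegralZl// RintegralZl// mulrC [X in _ + X]mulrC.
under eq_Rintegral do rewrite innc.
under [X in _ /\ X = _]eq_Rintegral do rewrite inns.
have bc a := bmeasM (bmeas_cst (measurableTypeR R) a) (bmeas_cosZ R k0).
have bs a := bmeasM (bmeas_cst (measurableTypeR R) a) (bmeas_sinZ R k0).
have ibc a := bmeas_rintegrable (haar1 R) (bc a).
have ibs a := bmeas_rintegrable (haar1 R) (bs a).
have ibc1 := bmeas_rintegrable (haar1 R) (bmeas_cosZ R k0).
have ibs1 := bmeas_rintegrable (haar1 R) (bmeas_sinZ R k0).
rewrite RintegralB//; [|exact: ibc|exact: ibs].
rewrite RintegralD//; [|exact: ibs|exact: ibc].
rewrite !RintegralZl//.
(* If [k0] is nonzero the outer integrals vanish; otherwise another coordinate is nonzero and the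
   inner ones do. *)
have [k00|k00] := eqVneq k0 0; last first.
  by rewrite Rintegral_haar1_cos// Rintegral_haar1_sin// !mulr0 subr0 addr0.
have [-> ->] : Ck = 0 /\ Sk = 0.
  apply: IH; case: (unliftP ord0 i) ki => [j ->|->]; last by rewrite tnth0 k00 eqxx.
  by rewrite tnthS => kj; exists j.
by rewrite !mul0r subr0 addr0.
Qed.

Section TrigPolynomials.
Variable d : nat.
Implicit Types (S : seq (d.-tuple int)) (a : d.-tuple int -> R[i]).

Definition trig S a (x : d.-tuple R) : R[i] :=
  \sum_(n <- S) a n * expi (dotZ n x).

Let diffZ (n m : d.-tuple int) := [tuple tnth n i - tnth m i | i < d].

Let dotZB n m (x : d.-tuple R) : dotZ n x - dotZ m x = dotZ (diffZ n m) x.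
Proof.
rewrite -sumrB; apply: eq_bigr => i _.
by rewrite tnth_mktuple rmorphB/= mulrBl.
Qed.

Lemma Re_sum (J : Type) (r : seq J) (F : J -> R[i]) :
  complex.Re (\sum_(j <- r) F j) = \sum_(j <- r) complex.Re (F j).
Proof. by apply: (big_morph (@complex.Re R)) => [[a b] [e f]|]. Qed.

Lemma Im_sum (J : Type) (r : seq J) (F : J -> R[i]) :
  complex.Im (\sum_(j <- r) F j) = \sum_(j <- r) complex.Im (F j).
Proof. by apply: (big_morph (@complex.Im R)) => [[a b] [e f]|]. Qed.

Lemma bmeas_Re_trig S a : bmeas (fun x => complex.Re (trig S a x)).
Proof.
under eq_fun do rewrite Re_sum; apply: bmeas_sum => n.
rewrite (_ : (fun x => _) = (fun x => complex.Re (a n) * cos (dotZ n x) -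
   complex.Im (a n) * sin (dotZ n x))); last first.
  by apply/funext => x; case: (a n).
by apply: bmeasB; apply: bmeasM; solve [exact: bmeas_cst|
  exact: bmeas_cos_dotZ|exact: bmeas_sin_dotZ].
Qed.

Lemma bmeas_Im_trig S a : bmeas (fun x => complex.Im (trig S a x)).
Proof.
under eq_fun do rewrite Im_sum; apply: bmeas_sum => n.
rewrite (_ : (fun x => _) = (fun x => complex.Re (a n) * sin (dotZ n x) +
   complex.Im (a n) * cos (dotZ n x))); last first.
  by apply/funext => x; case: (a n).
by apply: bmeasD; apply: bmeasM; solve [exact: bmeas_cst|
  exact: bmeas_cos_dotZ|exact: bmeas_sin_dotZ].
Qed.

Lemma bmeas_cabs_trig S a : bmeas (fun x => cabs (trig S a x) ^+ 2).
Proof.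
under eq_fun do rewrite cabs_sqr.
by apply: bmeasD; apply: bmeasX; [exact: bmeas_Re_trig|exact: bmeas_Im_trig].
Qed.

Lemma plancherel S a : uniq S ->
  \int[haar R d]_x cabs (trig S a x) ^+ 2 = nrm2 S a.
Proof.
move=> uS.
(* [p n m] and [q n m] are the real and imaginary parts of [a n * cconj (a m)]. *)
pose p n m := complex.Re (a n) * complex.Re (a m) +
  complex.Im (a n) * complex.Im (a m).
pose q n m := complex.Im (a n) * complex.Re (a m) -
  complex.Re (a n) * complex.Im (a m).
have E x : cabs (trig S a x) ^+ 2 = \sum_(n <- S) \sum_(m <- S)
    (p n m * cos (dotZ (diffZ n m) x) - q n m * sin (dotZ (diffZ n m) x)).
  transitivity (complex.Re (trig S a x * cconj (trig S a x))).
    by rewrite -cabs_sqrC.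
  rewrite /trig cconj_sum mulr_suml Re_sum; apply: eq_bigr => n _.
  rewrite mulr_sumr Re_sum; apply: eq_bigr => m _.
  rewrite -dotZB cosB sinB /p /q; case: (a n) (a m) => [u v] [u' v'] /=.
  ring.
under eq_Rintegral do rewrite E.
have bt n m : bmeas (fun x => p n m * cos (dotZ (diffZ n m) x)).
  by apply: bmeasM; [exact: bmeas_cst|exact: bmeas_cos_dotZ].
have bt' n m : bmeas (fun x => q n m * sin (dotZ (diffZ n m) x)).
  by apply: bmeasM; [exact: bmeas_cst|exact: bmeas_sin_dotZ].
rewrite Rintegral_sum; last first.
  by move=> n; apply: bmeas_rintegrable; apply: bmeas_sum => m; exact: bmeasB.
rewrite /nrm2; apply: eq_big_seq => n nS.
rewrite Rintegral_sum; last first.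
  by move=> m; apply: bmeas_rintegrable; exact: bmeasB.
have I1 m : \int[haar R d]_x (p n m * cos (dotZ (diffZ n m) x) -
    q n m * sin (dotZ (diffZ n m) x)) =
    p n m * \int[haar R d]_x cos (dotZ (diffZ n m) x) -
    q n m * \int[haar R d]_x sin (dotZ (diffZ n m) x).
  rewrite RintegralB//; [|exact: bmeas_rintegrable (bt n m)|
    exact: bmeas_rintegrable (bt' n m)].
  rewrite RintegralZl//; last exact: bmeas_rintegrable (bmeas_cos_dotZ _).
  by rewrite RintegralZl//; exact: bmeas_rintegrable (bmeas_sin_dotZ _).
rewrite (bigD1_seq n)//= big1 ?addr0 => [|m mn]; last first.
  have nm : exists i, tnth (diffZ n m) i != 0.
    apply: contrapT => H; move/eqP: mn; apply; apply: eq_from_tnth => i.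
    apply/eqP; rewrite eq_sym -subr_eq0; apply: contrapT => /negP nz.
    by apply: H; exists i; rewrite tnth_mktuple.
  by rewrite I1; have [-> ->] := Rintegral_char_eq0 nm; rewrite !mulr0 subr0.
have z (x : d.-tuple R) : dotZ (diffZ n n) x = 0 by rewrite -dotZB subrr.
under eq_Rintegral do rewrite z cos0 sin0 mulr1 mulr0 subr0.
rewrite (Rintegral_probability_cst (haar R d)).
by rewrite /p cabs_sqr !expr2.
Qed.

End TrigPolynomials.
End Plancherel.

(** * The L log L estimate of the weighted energy *)

Section LlogLEstimate.
Variables (R : realType) (d : nat).
Implicit Types (S : seq (d.-tuple int)) (u : d.-tuple int -> R[i]).
Implicit Types (x : d.-tuple R).
Local Open Scope complex_scope.
Variable V : d.-tuple R -> R.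
Hypothesis V0 : forall x, 0 <= V x.
Hypothesis mV : measurable_fun setT V.
Hypothesis iMV : rintegrable (haar R d) (fun x => Mfun (V x)).
Hypothesis MV1 : \int[haar R d]_x Mfun (V x) <= 1.

(** Allows levels in base [4] to be compared with the natural logarithm. The bound comes from
    [exp(-1/2) >= 1/2]. *)
Lemma expR1_le4 : expR 1 <= 4 :> R.
Proof.
have h : expR (- (1 / 2)) >= 1 / 2 :> R.
  by apply: le_trans (expR_ge1Dx _); lra.
have hp : 0 < expR (1 / 2) :> R by exact: expR_gt0.
have h2 : expR (1 / 2) <= 2 :> R.
  move: h; rewrite expRN -(ler_pM2r hp) mulVf ?gt_eqF//; lra.
have -> : 1 = 1 / 2 + 1 / 2 :> R by lra.
by rewrite expRD; nra.
Qed.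

Lemma Mfun_ge (t : R) : 0 <= t -> t <= Mfun t.
Proof.
move=> t0; rewrite /Mfun ler_peMr// -[leLHS](@expRK R) ler_ln ?posrE ?expR_gt0//.
  by rewrite lerDl.
by rewrite ltr_wpDr// expR_gt0.
Qed.

Lemma rintegrable_weight : rintegrable (haar R d) V.
Proof.
apply: (le_integrable _ _ _ iMV) => //; first exact/measurable_EFinP.
move=> x _ /=; rewrite !ger0_norm ?lee_fin// ?Mfun_ge//.
exact: le_trans (Mfun_ge (V0 x)).
Qed.

Lemma dyadic_level x : exists k : nat, V x < 4 ^+ k.+1 /\
  forall j, (j < k)%N -> 4 ^+ j.+1 <= V x.
Proof.
have ex : exists k : nat, V x < 4 ^+ k.+1.
  exists (Num.truncn (V x)); apply: lt_trans (truncnS_gt _) _.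
  by rewrite -natrX ltr_nat; exact: ltn_expl.
exists (ex_minn ex); case: ex_minnP => k Vk kmin; split=> // j jk.
by rewrite leNgt; apply/negP => /kmin; rewrite leqNgt jk.
Qed.

(** The source of the logarithm in [Mfun]: [k] counts the shells below the threshold at [x], and
    [e^k <= 4^k <= V x] for positive [k]. *)
Lemma dyadic_level_le_ln x k : (forall j, (j < k)%N -> 4 ^+ j.+1 <= V x) ->
  k%:R <= ln (expR 1 + V x).
Proof.
move=> Vk; have e0 : 0 < expR 1 + V x by rewrite ltr_wpDr// expR_gt0.
rewrite -[leLHS](@expRK R) ler_ln ?posrE ?expR_gt0//.
case: k Vk => [_|k /(_ k (leqnn _)) Vk].
  by rewrite expR0 ler_wpDr// -(@expR0 R) ler_expR.
rewrite -[k.+1%:R]mulr1 expRM_natl ler_wpDl ?expR_ge0// (le_trans _ Vk)//.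
by rewrite lerXn2r ?nnegrE ?expR_ge0// expR1_le4.
Qed.

Variable N : R.
Hypothesis N0 : 0 < N.
Local Notation lev := (@level R d N N0).

Definition wcoef u n : R[i] := (wgt n)%:C * u n.
(** The squared norm of [V^(1/2) (1-Delta)^(-d/4) u]. *)
Definition wenergy S u : R :=
  \int[haar R d]_x (V x * cabs (trig S (wcoef u) x) ^+ 2).

(* The frequencies below the threshold at [x]: the Hilbert-Schmidt part. *)
Definition hs_mask x n : R :=
  if (0 < lev n)%N && (4 ^+ lev n <= V x) then 1 else 0.
Definition hs_kernel x n : R[i] := (hs_mask x n * wgt n)%:C * expi (dotZ n x).
Definition hs_sum S u x : R[i] := \sum_(n <- S) hs_kernel x n * u n.
Definition hs_energy S u : R :=
  \int[haar R d]_x (V x * cabs (hs_sum S u x) ^+ 2).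

(** The cut-off is at a fixed level and does not depend on [x], so that Plancherel applies. *)
Definition tail_coef j u n : R[i] := if (j < lev n)%N then wcoef u n else 0.

Lemma bmeas_hs_mask n : bmeas (fun x => hs_mask x n).
Proof.
split; last first.
  by exists 1 => x; rewrite /hs_mask; case: ifP; rewrite ?normr1 ?normr0.
rewrite /hs_mask; case: (0 < lev n)%N => /=; last exact: measurable_cst.
by apply: measurable_fun_ifT; [exact: measurable_fun_ler|..].
Qed.

Lemma hs_sumE S u x : hs_sum S u x =
  \sum_(n <- S) (hs_mask x n)%:C * trig [:: n] (wcoef u) x.
Proof.
apply: eq_bigr => n _; rewrite /hs_kernel /trig big_seq1 /wcoef realcM.
by ring.
Qed.

Lemma bmeas_hs_sum S u : bmeas (fun x => cabs (hs_sum S u x) ^+ 2).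
Proof.
under eq_fun do rewrite cabs_sqr hs_sumE Re_sum Im_sum.
apply: bmeasD; apply: bmeasX; apply: bmeas_sum => n.
  under eq_fun do rewrite Re_realM.
  by apply: bmeasM; [exact: bmeas_hs_mask|exact: bmeas_Re_trig].
under eq_fun do rewrite Im_realM.
by apply: bmeasM; [exact: bmeas_hs_mask|exact: bmeas_Im_trig].
Qed.

Lemma rintegrable_hs_energy S u :
  rintegrable (haar R d) (fun x => V x * cabs (hs_sum S u x) ^+ 2).
Proof. by apply: rintegrableM; [exact: rintegrable_weight|exact: bmeas_hs_sum]. Qed.

Lemma rintegrable_wenergy S u :
  rintegrable (haar R d) (fun x => V x * cabs (trig S (wcoef u) x) ^+ 2).
Proof. by apply: rintegrableM; [exact: rintegrable_weight|exact: bmeas_cabs_trig]. Qed.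

Lemma hs_energy_ge0 S u : 0 <= hs_energy S u.
Proof. by apply: Rintegral_ge0 => x _; rewrite mulr_ge0 ?sqr_ge0. Qed.

Lemma hs_energyZ S (s : R) u :
  hs_energy S (fun n => s%:C * u n) = s ^+ 2 * hs_energy S u.
Proof.
rewrite /hs_energy -RintegralZl//; last exact: rintegrable_hs_energy.
apply: eq_Rintegral => x _.
have -> : hs_sum S (fun n => s%:C * u n) x = s%:C * hs_sum S u x.
  by rewrite /hs_sum mulr_sumr; apply: eq_bigr => n _; rewrite mulrCA.
by rewrite cabsM exprMn cabs_real real_normK ?num_real//; ring.
Qed.

Lemma hs_energy_eq S u v : {in S, u =1 v} -> hs_energy S u = hs_energy S v.
Proof.
move=> uv; apply: eq_Rintegral => x _; congr (_ * cabs _ ^+ 2).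
by apply: eq_big_seq => n /uv ->.
Qed.

Lemma hs_energy_ext S S1 u : uniq S -> uniq S1 -> {subset S <= S1} ->
  supported S u -> hs_energy S1 u = hs_energy S u.
Proof.
move=> uS uS1 SS1 su; apply: eq_Rintegral => x _; congr (_ * cabs _ ^+ 2).
by apply: big_extend => // n /su ->; rewrite mulr0.
Qed.

Lemma cabs_expi (t : R) : cabs (expi t) ^+ 2 = 1.
Proof. by rewrite cabs_sqr cos2Dsin2. Qed.

(** Only levels from [1] to [k] are unmasked at [x], so [levels_sum] gives [4 * 3^d * k], and [k] is
    at most the logarithm in [Mfun]. *)
Lemma nrm2_hs_kernel S x : uniq S ->
  V x * nrm2 S (hs_kernel x) <= 4 * 3 ^+ d * Mfun (V x).
Proof.
move=> uS; rewrite /Mfun mulrCA ler_wpM2l//.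
have [k [Vk kV]] := dyadic_level x.
apply: (@le_trans _ _ (4 * 3 ^+ d * k%:R)); last first.
  by rewrite ler_wpM2l ?mulr_ge0// dyadic_level_le_ln.
apply: le_trans (levels_sum N0 k uS).
rewrite /nrm2 [leRHS]big_mkcond/=; apply: ler_sum => n _.
rewrite /hs_kernel cabsM exprMn cabs_expi mulr1 cabs_real real_normK ?num_real//.
rewrite exprMn wgt_sqr /hs_mask.
have [l0|l0] /= := ltnP 0 (lev n); last by rewrite expr0n mul0r.
case: ifPn => [Vl|_]; last first.
  by rewrite expr0n mul0r; case: ifP; rewrite // invr_ge0 ltW// freq_gt0.
rewrite expr1n mul1r ifT// leqNgt; apply/negP => kl.
have := le_lt_trans Vl Vk; rewrite ltNge => /negP; apply.
by rewrite ler_eXn2l ?ltr1n.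
Qed.

(** A bound on the squared Hilbert-Schmidt norm: Bessel at each point [x] against the kernel, then
    integration of [nrm2_hs_kernel]. *)
Lemma hs_energy_sum_le S K (q : nat -> d.-tuple int -> R[i]) : uniq S ->
  orthonormal_family S K q -> \sum_(i < K) hs_energy S (q i) <= 4 * 3 ^+ d.
Proof.
move=> uS oq; rewrite /hs_energy -Rintegral_sum; last first.
  by move=> i; exact: rintegrable_hs_energy.
apply: (@le_trans _ _ (\int[haar R d]_x (4 * 3 ^+ d * Mfun (V x)))); last first.
  by rewrite RintegralZl// ler_piMr// mulr_ge0.
apply: le_Rintegral => //.
- by apply: rintegrable_sum => i; exact: rintegrable_hs_energy.
- exact: rintegrableZ.
move=> x _; rewrite -mulr_sumr; apply: le_trans (nrm2_hs_kernel x uS).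
by rewrite ler_wpM2l//; exact: bessel.
Qed.

(* With [k] least such that [V x < 4 ^+ k.+1], the frequencies above the
   threshold at [x] are those of level greater than [k]. *)
Lemma pointwise_split S u J x : (forall n, n \in S -> (lev n <= J)%N) ->
  (forall n, n \in S -> lev n = 0%N -> u n = 0) ->
  V x * cabs (trig S (wcoef u) x) ^+ 2 <= 2 * (V x * cabs (hs_sum S u x) ^+ 2) +
    2 * \sum_(j < J) 4 ^+ j.+1 * cabs (trig S (tail_coef j u) x) ^+ 2.
Proof.
move=> SJ u0; have [k [Vk kV]] := dyadic_level x.
have -> : trig S (wcoef u) x = hs_sum S u x + trig S (tail_coef k u) x.
  rewrite /hs_sum /trig -big_split/=; apply: eq_big_seq => n nS.
  rewrite /hs_kernel /hs_mask /tail_coef /wcoef.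
  have [l0|l0] := posnP (lev n); first by rewrite l0 (u0 n nS l0) !mulr0 mul0r addr0.
  (* By [Vk] and [kV] the mask at a positive level is on exactly when the level is at most [k], so
     mask and tail are complementary. *)
  have -> : (4 ^+ lev n <= V x) = ~~ (k < lev n)%N.
    apply/idP/idP; rewrite -leqNgt.
      move=> Vl; rewrite leqNgt; apply/negP => kl.
      have := le_lt_trans Vl Vk; rewrite ltNge => /negP; apply.
      by rewrite ler_eXn2l ?ltr1n.
    by move=> lk; rewrite -(prednK l0) kV// prednK.
  by case: ltnP => _ /=; rewrite ?mul0r ?mul1r ?add0r ?addr0// mulrAC.
apply: (le_trans (ler_wpM2l (V0 x) (cabs_sqrD _ _))).
rewrite mulrDr (mulrCA (V x) 2) lerD2l (mulrCA (V x) 2) ler_wpM2l//.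
(* The tail at [k] is one of the summands, [V x] being below its factor [4^(k+1)]; when [J <= k]
   that tail is empty. *)
have [kJ|Jk] := ltnP k J.
  rewrite (bigD1 (Ordinal kJ))//= -[leLHS]addr0 lerD//.
    by rewrite ler_wpM2r ?sqr_ge0// ltW.
  by apply: sumr_ge0 => i _; rewrite mulr_ge0 ?sqr_ge0// exprn_ge0.
rewrite [trig _ _ _](_ : _ = 0); last first.
  rewrite /trig big1_seq// => n /andP[_ nS]; rewrite /tail_coef ifF ?mul0r//.
  by rewrite ltnNge (leq_trans (SJ n nS)).
rewrite cabs0 expr0n mulr0; apply: sumr_ge0 => i _.
by rewrite mulr_ge0 ?sqr_ge0// exprn_ge0.
Qed.

Lemma geometric4 (l : nat) : \sum_(j < l) 4 ^+ j.+1 <= 2 * 4 ^+ l :> R.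
Proof.
elim: l => [|l IH]; first by rewrite big_ord0 mulr_ge0.
have X0 : 0 <= 4 ^+ l :> R by rewrite exprn_ge0.
by rewrite big_ord_recr/= exprS; lra.
Qed.

(** After exchanging the sums, a frequency of positive level [i] collects at most [2 * 4^i] from the
    geometric sum, and its weight is below [1 / (N * 4^(i-1))]: [8 / N] in all. *)
Lemma tail_sum S u J : uniq S -> (forall n, n \in S -> (lev n <= J)%N) ->
  \sum_(j < J) 4 ^+ j.+1 * nrm2 S (tail_coef j u) <= 8 / N * nrm2 S u.
Proof.
move=> uS SJ; rewrite /nrm2; under eq_bigr do rewrite mulr_sumr.
rewrite exchange_big/= mulr_sumr big_seq [leRHS]big_seq; apply: ler_sum => n nS.
have -> : \sum_(j < J) 4 ^+ j.+1 * cabs (tail_coef j u n) ^+ 2 =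
    (\sum_(j < lev n) 4 ^+ j.+1) * ((freq R n)^-1 * cabs (u n) ^+ 2).
  rewrite (big_ord_widen J (fun j => 4 ^+ j.+1))/=; last exact: SJ.
  rewrite mulr_suml [RHS]big_mkcond/=; apply: eq_bigr => j _.
  rewrite /tail_coef; case: ifP => _; last by rewrite cabs0 expr0n mulr0.
  by rewrite /wcoef cabsM exprMn cabs_real real_normK ?num_real// wgt_sqr.
rewrite mulrA ler_wpM2r ?sqr_ge0//.
have [->|l0] := posnP (lev n).
  by rewrite big_ord0 mul0r divr_ge0// ltW.
rewrite ler_pdivrMr ?freq_gt0// (le_trans (geometric4 _))//.
have := @level_lb R d N N0 n (lev n).-1; rewrite prednK// => /(_ (leqnn _)).
rewrite -[in X in _ -> X](prednK l0) exprS; set f := freq R n; set a := 4 ^+ _ => h.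
have -> : 8 / N * f = 8 * (f / N) by ring.
rewrite (_ : 2 * (4 * a) = 8 * a); last by ring.
by rewrite ler_pM2l ?ltr0n// ler_pdivlMr// mulrC ltW.
Qed.

(** Integrate [pointwise_split]; Plancherel evaluates each tail and [tail_sum] adds them up. *)
Lemma wenergy_le S u : uniq S ->
  (forall n, n \in S -> lev n = 0%N -> u n = 0) ->
  wenergy S u <= 2 * hs_energy S u + 16 / N * nrm2 S u.
Proof.
move=> uS u0.
pose J := \max_(n <- S) lev n.
have SJ n : n \in S -> (lev n <= J)%N by move=> nS; exact: leq_bigmax_seq.
have iS j : rintegrable (haar R d)
    (fun x => 4 ^+ j.+1 * cabs (trig S (tail_coef j u) x) ^+ 2).
  by apply: bmeas_rintegrable; apply: bmeasM; [exact: bmeas_cst|exact: bmeas_cabs_trig].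
have iT : rintegrable (haar R d) (fun x =>
    \sum_(j < J) 4 ^+ j.+1 * cabs (trig S (tail_coef j u) x) ^+ 2).
  by apply: rintegrable_sum => j; exact: iS.
apply: (@le_trans _ _ (\int[haar R d]_x (2 * (V x * cabs (hs_sum S u x) ^+ 2) +
    2 * \sum_(j < J) 4 ^+ j.+1 * cabs (trig S (tail_coef j u) x) ^+ 2))).
  apply: le_Rintegral => //; first exact: rintegrable_wenergy.
    by apply: rintegrableD; apply: rintegrableZ => //; exact: rintegrable_hs_energy.
  by move=> x _; exact: pointwise_split.
rewrite RintegralD//; last 2 first.
- by apply: rintegrableZ; exact: rintegrable_hs_energy.
- exact: rintegrableZ.
rewrite RintegralZl//; last exact: rintegrable_hs_energy.
rewrite RintegralZl// lerD2l Rintegral_sum; last by move=> j; exact: iS.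
rewrite (_ : 16 / N * nrm2 S u = 2 * (8 / N * nrm2 S u)); last by ring.
rewrite ler_wpM2l//; apply: le_trans (tail_sum u uS SJ).
rewrite le_eqVlt; apply/orP; left; apply/eqP; apply: eq_bigr => j _.
by rewrite RintegralZl ?plancherel//; exact: bmeas_rintegrable (bmeas_cabs_trig _ _).
Qed.

End LlogLEstimate.

(** * Integrals of complex-valued functions *)

Section ComplexIntegral.
Variables (R : realType) (d : nat).
Implicit Types (g h : d.-tuple R -> R[i]) (k : d.-tuple R -> R).

Definition cint g : R[i] := Complex (\int[haar R d]_x complex.Re (g x))
  (\int[haar R d]_x complex.Im (g x)).
Definition cintegrable g :=
  rintegrable (haar R d) (fun x => complex.Re (g x)) /\
  rintegrable (haar R d) (fun x => complex.Im (g x)).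

Lemma cintegrableZ (c : R[i]) g :
  cintegrable g -> cintegrable (fun x => c * g x).
Proof.
move=> [gr gi]; split; under eq_fun do rewrite ?ReM ?ImM;
  by apply: rintegrableD; exact: rintegrableZ.
Qed.

Lemma cintZ (c : R[i]) g :
  cintegrable g -> cint (fun x => c * g x) = c * cint g.
Proof.
move=> [gr gi]; rewrite /cint; under eq_Rintegral do rewrite ReM.
under [X in Complex _ X]eq_Rintegral do rewrite ImM.
rewrite !RintegralD//; try exact: rintegrableZ.
rewrite !RintegralZl//; case: c => a b /=.
by rewrite mulNr.
Qed.

Lemma cint_sum (J : Type) (r : seq J) (F : J -> d.-tuple R -> R[i]) :
  (forall j, cintegrable (F j)) ->
  cint (fun x => \sum_(j <- r) F j x) = \sum_(j <- r) cint (F j).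
Proof.
move=> iF; rewrite /cint; under eq_Rintegral do rewrite Re_sum.
under [X in Complex _ X]eq_Rintegral do rewrite Im_sum.
rewrite Rintegral_sum; last by move=> j; case: (iF j).
rewrite Rintegral_sum; last by move=> j; case: (iF j).
elim: r => [|j r IH]; first by rewrite !big_nil.
by rewrite !big_cons -IH.
Qed.

Lemma cintegrable_sum (J : Type) (r : seq J) (F : J -> d.-tuple R -> R[i]) :
  (forall j, cintegrable (F j)) -> cintegrable (fun x => \sum_(j <- r) F j x).
Proof.
move=> iF; split.
  by under eq_fun do rewrite Re_sum; apply: rintegrable_sum => j; case: (iF j).
by under eq_fun do rewrite Im_sum; apply: rintegrable_sum => j; case: (iF j).
Qed.

Lemma normr_Rintegral_le (p k : d.-tuple R -> R) : rintegrable (haar R d) p ->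
  rintegrable (haar R d) k -> (forall x, `|p x| <= k x) ->
  `|\int[haar R d]_x p x| <= \int[haar R d]_x k x.
Proof.
move=> ip ik pk; rewrite ler_norml; apply/andP; split; last first.
  by apply: le_Rintegral => // x _; rewrite (le_trans (ler_norm _)).
rewrite lerNl -mulN1r -RintegralZl//; apply: le_Rintegral => //.
  exact: rintegrableZ.
by move=> x _; rewrite mulN1r (le_trans _ (pk x))// ler_normr lexx orbT.
Qed.

(** Real and imaginary parts are bounded separately, hence the factor [2]. *)
Lemma cabs_cint_le g k : cintegrable g -> rintegrable (haar R d) k ->
  (forall x, cabs (g x) <= k x) -> cabs (cint g) <= 2 * \int[haar R d]_x k x.
Proof.
move=> [gr gi] ik gk; apply: (le_trans (cabs_le_ReIm _)).
rewrite mulr_natl mulr2n lerD//; apply: normr_Rintegral_le => // x.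
  by rewrite (le_trans (cabs_ge_Re _)).
by rewrite (le_trans (cabs_ge_Im _)).
Qed.

Lemma haar_intE (p : d.-tuple R -> R) : rintegrable (haar R d) p ->
  haar_int p = \int[haar R d]_x p x.
Proof.
move=> ip; have mp : measurable_fun setT p.
  by apply/measurable_EFinP; exact: measurable_int ip.
have ipos : rintegrable (haar R d) (fun x => Num.max (p x) 0).
  exact: (integrable_funrpos measurableT ip).
have ineg : rintegrable (haar R d) (fun x => Num.max (- p x) 0).
  exact: (integrable_funrneg measurableT ip).
rewrite /haar_int tint_haar; last 2 first.
- by case/integrableP: ipos.
- by move=> x; rewrite lee_fin le_max lexx orbT.
rewrite tint_haar; last 2 first.
- by case/integrableP: ineg.
- by move=> x; rewrite lee_fin le_max lexx orbT.
rewrite -[X in _ - X]/(\int[haar R d]_x Num.max (- p x) 0).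
rewrite -[X in X - _]/(\int[haar R d]_x Num.max (p x) 0).
rewrite -RintegralB//; apply: eq_Rintegral => x _.
by case: (leP 0 (p x)) => h; case: (leP 0 (- p x)) => h'; lra.
Qed.

End ComplexIntegral.

(** * Singular values of the operator *)

Section CwikelSolomyak.
Variables (R : realType) (d : nat) (f : d.-tuple R -> R[i]) (l : R).
Local Open Scope complex_scope.
Hypothesis mf : cmeasurable f.
Hypothesis l0 : 0 < l.
Hypothesis fl : (tint (fun x => (Mfun (cabs (f x) / l))%:E) <= 1)%E.

(** Dividing by an admissible [l] brings the integral of [Mfun (V x)] to at most [1]; the factor [l]
    returns through [fE]. *)
Let V x := cabs (f x) / l.

Let V0 x : 0 <= V x.
Proof. by rewrite divr_ge0 ?cabs_ge0// ltW. Qed.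

Let mV : measurable_fun setT V.
Proof.
have ms : measurable_fun setT (@Num.sqrt R).
  by apply: continuous_measurable_fun => x; exact: sqrt_continuous.
apply: measurable_funM => //; apply: (measurableT_comp ms).
by case: mf => mr mi; apply: measurable_funD; exact: measurable_funX.
Qed.

Let mMV : measurable_fun setT (fun x => Mfun (V x)).
Proof.
apply: measurable_funM => //; apply: measurableT_comp => //.
exact: measurable_funD.
Qed.

Let Mfun_ge0 x : 0 <= Mfun (V x).
Proof. exact: le_trans (Mfun_ge (V0 x)). Qed.

Let intMV : (\int[haar R d]_x (Mfun (V x))%:E <= 1)%E.
Proof.
by rewrite -tint_haar//; exact/measurable_EFinP.
Qed.

Let iMV : rintegrable (haar R d) (fun x => Mfun (V x)).
Proof.
apply/integrableP; split; first exact/measurable_EFinP.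
under eq_integral do rewrite gee0_abs ?lee_fin//.
exact: le_lt_trans intMV (ltry 1).
Qed.

Let MV1 : \int[haar R d]_x Mfun (V x) <= 1.
Proof. by rewrite -lee_fin Rintegral_EFin. Qed.

Let fE x : cabs (f x) = l * V x.
Proof. by rewrite /V mulrC divfK// gt_eqF. Qed.

Let iV := rintegrable_weight V0 mV iMV.

Let iRe : rintegrable (haar R d) (fun x => complex.Re (f x)).
Proof.
apply: (le_integrable _ _ _ (rintegrableZ l iV)) => //.
  by apply/measurable_EFinP; case: mf.
move=> x _ /=; rewrite lee_fin (le_trans (cabs_ge_Re _))// fE.
by rewrite ger0_norm// mulr_ge0// ltW.
Qed.

Let iIm : rintegrable (haar R d) (fun x => complex.Im (f x)).
Proof.
apply: (le_integrable _ _ _ (rintegrableZ l iV)) => //.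
  by apply/measurable_EFinP; case: mf.
move=> x _ /=; rewrite lee_fin (le_trans (cabs_ge_Im _))// fE.
by rewrite ger0_norm// mulr_ge0// ltW.
Qed.

Let integrand S (a : d.-tuple int -> R[i]) S' b x :=
  f x * trig S a x * cconj (trig S' b x).

Let integrand_int S a S' b : cintegrable (integrand S a S' b).
Proof.
have E x :
  (complex.Re (integrand S a S' b x) =
    complex.Re (f x) * (complex.Re (trig S a x) * complex.Re (trig S' b x) +
      complex.Im (trig S a x) * complex.Im (trig S' b x)) +
    complex.Im (f x) * (complex.Re (trig S a x) * complex.Im (trig S' b x) -
      complex.Im (trig S a x) * complex.Re (trig S' b x))) *
  (complex.Im (integrand S a S' b x) =
    complex.Im (f x) * (complex.Re (trig S a x) * complex.Re (trig S' b x) +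
      complex.Im (trig S a x) * complex.Im (trig S' b x)) +
    complex.Re (f x) * (complex.Im (trig S a x) * complex.Re (trig S' b x) -
      complex.Re (trig S a x) * complex.Im (trig S' b x))).
  rewrite /integrand.
  case: (f x) (trig S a x) (trig S' b x) => [u v] [u' v'] [u'' v''] /=.
  by split; ring.
have br := @bmeas_Re_trig R d; have bi := @bmeas_Im_trig R d.
have bp : bmeas (fun x => complex.Re (trig S a x) * complex.Re (trig S' b x) +
    complex.Im (trig S a x) * complex.Im (trig S' b x)).
  by apply: bmeasD; exact: bmeasM.
have bm : bmeas (fun x => complex.Re (trig S a x) * complex.Im (trig S' b x) -
    complex.Im (trig S a x) * complex.Re (trig S' b x)).
  by apply: bmeasB; exact: bmeasM.
have bm' : bmeas (fun x => complex.Im (trig S a x) * complex.Re (trig S' b x) -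
    complex.Re (trig S a x) * complex.Im (trig S' b x)).
  by apply: bmeasB; exact: bmeasM.
by split; under eq_fun do rewrite E; apply: rintegrableD; exact: rintegrableM.
Qed.

Let delta1 (n : d.-tuple int) : R[i] := (wgt n)%:C.
(** The matrix of the operator in the basis of exponentials. *)
Let tmat n m : R[i] := cint (integrand [:: n] delta1 [:: m] delta1).

Let qform_cint S c S' c' :
  qform f S c S' c' = cint (integrand S (wcoef c) S' (wcoef c')).
Proof.
have [ir ii] := integrand_int S (wcoef c) S' (wcoef c').
rewrite /qform /cint -(haar_intE ir) -(haar_intE ii).
by [].
Qed.

Let qformE S c S' c' : qform f S c S' c' =
  \sum_(n <- S) \sum_(m <- S') c n * cconj (c' m) * tmat n m.
Proof.
rewrite qform_cint.
have -> : integrand S (wcoef c) S' (wcoef c') = fun x =>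
    \sum_(n <- S) \sum_(m <- S')
      c n * cconj (c' m) * integrand [:: n] delta1 [:: m] delta1 x.
  apply/funext => x; rewrite /integrand /trig.
  under [RHS]eq_bigr => n _ do under eq_bigr => m _ do rewrite !big_seq1.
  rewrite cconj_sum [f x * _]mulr_sumr mulr_suml; apply: eq_bigr => n _.
  rewrite mulr_sumr; apply: eq_bigr => m _.
  by rewrite /wcoef /delta1 !cconjM; ring.
have iT n m := integrand_int [:: n] delta1 [:: m] delta1.
rewrite cint_sum; last by move=> n; apply: cintegrable_sum => m; exact: cintegrableZ.
apply: eq_bigr => n _; rewrite cint_sum; last by move=> m; exact: cintegrableZ.
by apply: eq_bigr => m _; rewrite cintZ.
Qed.

Let form_le S (u v : d.-tuple int -> R[i]) :
  cabs (form S tmat u v) <= l * wenergy V S u + l * wenergy V S v.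
Proof.
have -> : form S tmat u v = cint (integrand S (wcoef u) S (wcoef v)).
  by rewrite -qform_cint qformE.
have iP w := rintegrable_wenergy V0 mV iMV S w.
(* AM-GM instead of Cauchy-Schwarz: [|Ju| |Jv| <= (|Ju|^2 + |Jv|^2) / 2]. *)
pose h x := l / 2 *
  (V x * cabs (trig S (wcoef u) x) ^+ 2 + V x * cabs (trig S (wcoef v) x) ^+ 2).
have ih : rintegrable (haar R d) h by apply: rintegrableZ; exact: rintegrableD.
have gh x : cabs (integrand S (wcoef u) S (wcoef v) x) <= h x.
  rewrite /integrand !cabsM cabsJ fE /h.
  set p := cabs _; set q := cabs _.
  have := sqr_ge0 (p - q); have := mulr_ge0 (ltW l0) (V0 x).
  set w := l * V x => w0 pq.
  have -> : l / 2 * (V x * p ^+ 2 + V x * q ^+ 2) = w * ((p ^+ 2 + q ^+ 2) / 2).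
    by rewrite /w; field.
  rewrite -mulrA ler_wpM2l//.
  by move: pq; rewrite sqrrB; lra.
apply: (le_trans (cabs_cint_le (integrand_int _ _ _ _) ih gh)).
rewrite RintegralZl//; last exact: rintegrableD.
rewrite RintegralD; [|exact: measurableT|exact: iP|exact: iP].
rewrite -/(wenergy V S u) -/(wenergy V S v) le_eqVlt; apply/orP; left.
by apply/eqP; field.
Qed.

Lemma sing_val_le k :
  (sing_val f k <= (720 * 3 ^+ d * l / k.+1%:R)%:E)%E.
Proof.
have d3 : 0 < 3 ^+ d :> R by rewrite exprn_gt0.
have k0 : 0 < k.+1%:R :> R by rewrite ltr0n.
have rank_count (x y z : R) : x <= z -> y <= 4 * z -> 4 * (x + y) <= 20 * z.
  by lra.
(* There will be at most [3^d * N] low frequencies and [4 * 3^d * N] greedy vectors, [K] in all;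
   [20 * 3^d * N = k + 1] then gives [4 * K <= k + 1], hence [K + K <= k]. *)
pose N : R := k.+1%:R / (20 * 3 ^+ d).
have N0 : 0 < N by rewrite divr_gt0// mulr_gt0.
(* With threshold [1/2] no frequency is low, so [wenergy] is bounded. *)
have half0 : 0 < 1 / 2 :> R by lra.
have hs_energy_sumN N' (N'0 : 0 < N') S K (q : nat -> d.-tuple int -> R[i]) :
    uniq S -> orthonormal_family S K q ->
    \sum_(i < K) hs_energy V N'0 S (q i) <= 4 * 3 ^+ d.
  exact: hs_energy_sum_le.
(* From [wenergy_le] at threshold [1/2] and the trace bound: [8 = 2 * 4] and [32 = 16 / (1/2)]. *)
pose B : R := l * (8 * 3 ^+ d + 32).
have B0 : 0 < B by rewrite mulr_gt0// addr_gt0// mulr_gt0.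
have wenergy_bounded S : uniq S -> forall u, l * wenergy V S u <= B * nrm2 S u.
  move=> uS u; rewrite /B -mulrA ler_wpM2l ?(ltW l0)//.
  apply: (le_trans (wenergy_le V0 mV iMV (N0 := half0) uS _)).
    move=> n nS n0; have := @level_ub R d _ half0 n; rewrite n0 expr0 mulr1.
    by move=> h; exfalso; have := freq_ge1 R n; lra.
  have := summable_form_bounded (hs_energyZ V0 mV iMV half0)
    (@hs_energy_eq R d V _ half0)
    (hs_energy_sumN _ half0) u uS.
  by have := nrm2_ge0 S u; lra.
have [L [uL HL sL]] := @low_enum R d N N0.
(* Unit vectors at the low frequencies: orthogonality to them kills the coefficients of level [0],
   as [wenergy_le] requires. *)
pose q0 i n : R[i] := (n == nth [tuple 0 | _ < d] L i)%:R.
have nthL i : (i < size L)%N -> nth [tuple 0 | _ < d] L i \in L by exact: mem_nth.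
have sq0 i : (i < size L)%N -> supported L (q0 i).
  move=> iL n nL; rewrite /q0; case: eqP => // nE.
  by move: nL; rewrite nE nthL.
have ipq0 S u i : uniq S -> {subset L <= S} -> (i < size L)%N ->
    ip S u (q0 i) = u (nth [tuple 0 | _ < d] L i).
  move=> uS LS iL; rewrite /ip.
  rewrite (bigD1_seq (nth [tuple 0 | _ < d] L i))/=; [|exact/LS/nthL|by []].
  rewrite big1 => [|n /negbTE nE]; last by rewrite /q0 nE cconjE conjc0 mulr0.
  by rewrite /q0 eqxx cconjE conjc1 mulr1 addr0.
have oq0 : orthonormal_family L (size L) q0.
  by move=> i j iL jL; rewrite ipq0// /q0 nth_uniq// eq_sym.
have iN0 : 0 < N^-1 by rewrite invr_gt0.
have [m [S0 [q [[uS0 LS0] mC [sq oq] qq0 small]]]] :=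
  greedy_orthonormal (hs_energy_ge0 V0 N0) (hs_energyZ V0 mV iMV N0)
   (@hs_energy_ext R d V _ N0) (@hs_energy_eq R d V _ N0)
   (hs_energy_sumN _ N0) iN0 uL sq0 oq0.
pose K := (size L + m)%N.
have Kk : (K + K <= k)%N.
  have : 4 * (K%:R : R) <= k.+1%:R.
    have -> : k.+1%:R = 20 * (3 ^+ d * N) :> R.
      by rewrite mulrA /N mulrC divfK// gt_eqF// mulr_gt0.
    rewrite /K natrD; apply: rank_count => //.
    by rewrite mulrA mulrC -ler_pdivrMl.
  by rewrite -natrM ler_nat; move: K => K4; clear -K4; lia.
(* [18 = 2 + 16]: [hs_energy] is at most [1 / N] per unit of [nrm2] and enters [wenergy_le] with
   factor [2]. *)
pose eps := l * (18 / N).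
have eps0 : 0 <= eps by rewrite mulr_ge0 ?divr_ge0// ltW.
have wenergy_small S : uniq S -> {subset S0 <= S} -> forall u,
    (forall i, (i < K)%N -> ip S u (q i) = 0) ->
    l * wenergy V S u <= eps * nrm2 S u.
  move=> uS SS u uq; rewrite /eps -mulrA ler_wpM2l ?(ltW l0)//.
  apply: (le_trans (wenergy_le V0 mV iMV (N0 := N0) uS _)).
    move=> n nS /eqP; rewrite -HL => nL.
    have iL : (index n L < size L)%N by rewrite index_mem.
    rewrite -[n](nth_index [tuple 0 | _ < d] nL) -(ipq0 S)//.
      by rewrite -qq0// uq// ltn_addr.
    by move=> n' /LS0/SS.
  have := small S uS SS u uq; rewrite mulrC; lra.
have [a [b [ab_l2 ab]]] := @finite_rank_approx R _ tmat
  (fun S u => l * wenergy V S u) B B0 (fun S _ u v => form_le S u v)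
  wenergy_bounded K S0 q eps uS0 sq oq eps0 wenergy_small k Kk.
apply: (@le_trans _ _ (dist_norm f a b)).
  by apply: ereal_inf_lbound; exists a, b.
apply: ge_ereal_sup => _ [S [c [S' [c' [[uS c1] [uS' c'1] ->]]]]].
rewrite lee_fin qformE (le_trans (ab _ _ _ _ uS uS' c1 c'1))//.
(* [eps + eps = 36 * l / N] and [1 / N = 20 * 3^d / (k + 1)], whence [720]. *)
rewrite /eps /N le_eqVlt; apply/orP; left; apply/eqP.
by field; rewrite !gt_eqF.
Qed.

End CwikelSolomyak.

(** * The weak-type bound with the Orlicz norm *)

Theorem theorem1p1 (R : realType) (d : nat) :
  exists c : R, forall f : d.-tuple R -> R[i],
    in_LM f -> (weakL1_norm f <= c%:E * LM_norm f)%E.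
Proof.
have c0 : 0 < 720 * 3 ^+ d :> R.
  by apply: mulr_gt0; [rewrite ltr0n|rewrite exprn_gt0].
exists (720 * 3 ^+ d) => f [mf _].
(* Moving the constant to the left exposes the infimum, so one admissible [l], and then one [k],
   suffices. *)
rewrite -lee_pdivrMl//; apply: le_ereal_inf_tmp => _ [l [l0 fl] <-].
rewrite lee_pdivrMl//; apply: ge_ereal_sup => _ [k _ <-].
apply: (le_trans (lee_wpmul2l _ (sing_val_le mf l0 fl k))); first by rewrite lee_fin.
rewrite -!EFinM lee_fin le_eqVlt; apply/orP; left; apply/eqP.
by rewrite mulrC divfK// pnatr_eq0.
Qed.
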